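(* There exist $L_0>0$ and a set $E\subset[L_0,\infty)$ of Lebesgue measure zero such that: (a) if $0<L<L_0$, then (for no $(c_1,c_2)$) is there a solution $u$ of $$\tfrac12u_x^2=W(u)+c_1u+c_2\qquad(\ast)$$ with principal period $L$ satisfying $$\int_{u_m}^{u_M}\frac{u\,du}{\sqrt{P_c(u)}}=0;\qquad(\ast\ast)$$ (b) if $L\in[L_0,\infty)\setminus E$, then the set $$\mathcal{P}_L=\{(c_1,c_2)\in\mathcal{C}:\text{ there is a solution of }(\ast)\text{ with principal period }L\text{ satisfying }(\ast\ast)\}$$ is non-empty and finite. For $c\in\mathcal{P}_L$ the principal period $L$ satisfies $$\int_{u_m}^{u_M}\frac{du}{\sqrt{P_c(u)}}=\frac L2.$$
   Context: $W(v)=\frac14(v^2-1)^2$, and for $c=(c_1,c_2)\in\mathbb{R}^2$, $P_c(u)=2(W(u)+c_1u+c_2)$. Solutions of $(\ast)$ are smooth real functions on $\mathbb{R}$; for a nonconstant periodic solution, $u_m=\min u$ and $u_M=\max u$, and $u_m<0<u_M$. Principal period means the smallest positive period (constant functions have none). Condition $(\ast\ast)$ expresses that $u$ has zero mean over a period. $\mathcal{C}=\{(c_1,c_2):c_2\in(-\frac14,0),\ |c_1|<r(c_2)\}$, where $r(c_2)$ is the supremum of those $c_1>0$ for which $P_{(c_1,c_2)}$ has four distinct real roots $u_1<u_m<0<u_M<u_2$ (the two middle roots are the minimum and maximum of the corresponding periodic solution). *)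

(* Defs.v *)
From HB Require Import structures.
From mathcomp Require Import all_boot all_order all_algebra.
From mathcomp Require Import all_classical all_reals all_analysis.

Set Implicit Arguments.
Unset Strict Implicit.
Unset Printing Implicit Defensive.

Import Order.TTheory GRing.Theory Num.Theory.
Import numFieldNormedType.Exports.

Local Open Scope classical_set_scope.
Local Open Scope ring_scope.

Section Defs.
Variable R : realType.
Implicit Types (v x L m : R) (c : R * R) (u : R -> R).

Definition W v : R := 4^-1 * (v ^+ 2 - 1) ^+ 2.

Definition P c v : R := 2 * (W v + c.1 * v + c.2).

Definition smooth u : Prop := forall (n : nat) x, derivable (derive1n n u) x 1.

Definition solution c u : Prop :=
  smooth u /\
  forall x, 2^-1 * derive1 u x ^+ 2 = W (u x) + c.1 * u x + c.2.

(* A constant function has no principal period: every positive number is a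
   period of it. *)
Definition principal_period u L : Prop :=
  [/\ 0 < L, periodic u L & forall T : R, 0 < T -> periodic u T -> L <= T].

Definition is_min u m : Prop := range u m /\ lbound (range u) m.

Definition is_max u m : Prop := range u m /\ ubound (range u) m.

(* The integrand is singular at the endpoints, so the integrals are Lebesgue
   integrals over the open interval, with values in \bar R.  The value is 0
   only if the positive and negative parts are both finite (+oo - +oo = -oo). *)
Definition moment_integral c (a b : R) : \bar R :=
  (\int[lebesgue_measure]_(v in `]a, b[) (v / Num.sqrt (P c v))%:E)%E.

Definition time_integral c (a b : R) : \bar R :=
  (\int[lebesgue_measure]_(v in `]a, b[) ((Num.sqrt (P c v))^-1)%:E)%E.

Definition zero_mean c u : Prop :=
  exists um uM : R,
    [/\ is_min u um, is_max u uM & moment_integral c um uM = 0%E].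

Definition zero_mean_solution L c u : Prop :=
  [/\ solution c u, principal_period u L & zero_mean c u].

Definition four_roots c : Prop :=
  exists u1 um uM u2 : R,
    [/\ u1 < um, um < 0, 0 < uM & uM < u2] /\
    [/\ P c u1 = 0, P c um = 0, P c uM = 0 & P c u2 = 0].

Definition r (c2 : R) : R := sup [set c1 | 0 < c1 /\ four_roots (c1, c2)].

Definition calC : set (R * R) :=
  [set c | - 4^-1 < c.2 < 0 /\ `|c.1| < r c.2].

Definition calP L : set (R * R) :=
  [set c | calC c /\ exists u, zero_mean_solution L c u].

End Defs.

Arguments calC R : clear implicits.

(* Main.v *)
(* The zero-mean condition forces symmetry.  For a nonconstant periodic solution
   with range [m - l, m + l], the quartic 2 P factors as
   (l^2 - w^2) (B - (w + 2 m)^2) with w = v - m.  If m > 0, the moment integrand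
   exceeds the odd function w / sqrt ((l^2 - w^2) (B - 4 m^2 - w^2) / 2), whose
   integral vanishes, so the moment is positive; it is negative if m < 0.  Hence
   m = 0, c1 = 0, and with k = l^2 in (0, 1) the solution is a translate of
   sqrt k * sin phi, where phi' = sqrt (1 - k (1 + sin^2 phi) / 2).  Its period is
   2 * half_period k, where half_period is continuous, strictly increasing, equal
   to pi at k = 0 and unbounded as k tends to 1.  So one can take L0 = 2 pi and
   E = {2 pi}, and then P_L is a singleton. *)

(* The equation is of first order and loses uniqueness where [u'] vanishes, so by itself it cannot
   identify a solution with a translate of the model. Smoothness repairs this: a nonconstant
   solution obeys [u'' = u^3 - u + c1], whose bounded solutions are determined by position and
   velocity at one point. Matching a maximum of one solution with a maximum of the other then
   identifies them. The same uniqueness excludes [k = 1], where the extreme values are equilibria.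

   The formula for [phi'] comes from substituting [u = sqrt k * sin phi] in
   [u'^2 = (k - u^2) (2 - k - u^2) / 2]: the factor [k cos^2 phi] cancels, and with it the
   singularity at the turning points. Travel times in [phi] thus have regular integrands for
   [k < 1]; singular integrals in [u] remain only in the moment and in the time integral.

   The comparison for the moment replaces [(w + 2 m)^2] by its even part [w^2 + 4 m^2]. *)
Require Import Defs.
From HB Require Import structures.
From mathcomp Require Import all_boot all_order all_algebra.
From mathcomp Require Import all_classical all_reals all_analysis.
From mathcomp Require Import measurable_realfun ring lra.

Import Order.TTheory GRing.Theory Num.Theory.
Import numFieldNormedType.Exports.

Local Open Scope classical_set_scope.
Local Open Scope ring_scope.

(** * Derivative rules, comparison of increments, Gronwall *)

Section RealDerivatives.
Set Implicit Arguments.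
Unset Strict Implicit.
Context {R : realType}.
Implicit Types (f g : R -> R) (x a b : R).

(** The rules are put in pointwise form so that the derivative of an explicit expression can be
    assembled as a term, its value being simplified afterwards through [is_derive_eq]. *)
Lemma is_derive1_add f g x a b : is_derive x 1 f a -> is_derive x 1 g b ->
  is_derive x 1 (fun y => f y + g y) (a + b).
Proof. exact: is_deriveD. Qed.

Lemma is_derive1_opp f x a : is_derive x 1 f a ->
  is_derive x 1 (fun y => - f y) (- a).
Proof. exact: is_deriveN. Qed.

Lemma is_derive1_mul f g x a b : is_derive x 1 f a -> is_derive x 1 g b ->
  is_derive x 1 (fun y => f y * g y) (f x * b + g x * a).
Proof. exact: is_deriveM. Qed.

Lemma is_derive1_exp f n x a : is_derive x 1 f a ->
  is_derive x 1 (fun y => f y ^+ n) (n%:R * f x ^+ n.-1 * a).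
Proof.
move=> df; have -> : (fun y => f y ^+ n) = f ^+ n by rewrite exprfctE.
exact: is_deriveX.
Qed.

Lemma is_derive1_const (c x : R) : is_derive x 1 (fun=> c) 0.
Proof. exact: is_derive_cst. Qed.

Lemma is_derive1_id x : is_derive x 1 (fun y => y) 1.
Proof. exact: is_derive_id. Qed.

Lemma is_derive1_chain f g x a b : is_derive (g x) 1 f a ->
  is_derive x 1 g b -> is_derive x 1 (fun y => f (g y)) (a * b).
Proof. exact: is_derive1_comp. Qed.

Lemma is_derive_continuous f x a : is_derive x 1 f a -> {for x, continuous f}.
Proof.
move=> [df _]; apply: differentiable_continuous.
by rewrite -derivable1_diffP.
Qed.

Lemma is_derive_segment_continuous f (df : R -> R) a b :
  (forall x, a <= x <= b -> is_derive x 1 f (df x)) ->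
  {within `[a, b], continuous f}.
Proof.
move=> dfE; apply: continuous_in_subspaceT => x; rewrite inE/= in_itv/= => xab.
exact: is_derive_continuous (dfE x xab).
Qed.

(** Mean value theorem for [g - f]. Since [half_period] is an increment of a primitive, this
    replaces monotonicity of the integral in the period estimates. *)
Lemma is_derive_le_increment f g (df dg : R -> R) a b : a <= b ->
  {within `[a, b], continuous f} -> {within `[a, b], continuous g} ->
  (forall x, a < x < b -> is_derive x 1 f (df x)) ->
  (forall x, a < x < b -> is_derive x 1 g (dg x)) ->
  (forall x, a < x < b -> df x <= dg x) ->
  f b - f a <= g b - g a.
Proof.
rewrite le_eqVlt => /predU1P[->|ab] cf cg fE gE fg; first by rewrite !subrr.
have ch : {within `[a, b], continuous (g - f)}.
  by move=> x; apply: (@continuousB R R (subspace `[a, b]) g f x); [exact: cg|exact: cf].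
have [|c cab] := @MVT R (g - f) (dg - df) a b ab _ ch.
  by move=> x; rewrite in_itv/= => xab; apply: is_deriveB; [exact: gE|exact: fE].
rewrite !fctE => E; rewrite in_itv/= in cab.
by have := fg c cab; nra.
Qed.

(* [f x * expR (- K * x)] is nonincreasing and [f x * expR (K * x)] is
   nondecreasing. *)
Lemma gronwall_eq0 f (df : R -> R) (K x0 : R) :
  (forall x, is_derive x 1 f (df x)) -> (forall x, 0 <= f x) ->
  (forall x, `|df x| <= K * f x) -> f x0 = 0 -> forall x, f x = 0.
Proof.
move=> fE f0 fK fx0 x; apply/eqP; rewrite eq_le f0 andbT.
have expE (k y : R) : is_derive y 1 (fun y => f y * expR (k * y))
    ((df y + k * f y) * expR (k * y)).
  have := is_derive1_mul (fE y) (is_derive1_chain (is_derive_expR _)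
    (is_derive1_mul (is_derive1_const k y) (is_derive1_id y))).
  by move=> /is_derive_eq; apply; rewrite /=; ring.
have cE k a b := is_derive_segment_continuous (fun y (_ : a <= y <= b) => expE k y).
have c0 (a b : R) : {within `[a, b], continuous (fun=> 0 : R)}.
  exact: (is_derive_segment_continuous (fun y _ => is_derive1_const 0 y)).
have [xx0|x0x] := leP x0 x.
- have := is_derive_le_increment xx0 (cE (- K) _ _) (c0 _ _)
    (fun y _ => expE (- K) y) (fun y _ => is_derive1_const 0 y).
  rewrite fx0 mul0r subrr subr0 pmulr_lle0 ?expR_gt0//; apply => y _.
  rewrite pmulr_lle0 ?expR_gt0//; have := fK y; have := ler_norm (df y); lra.
- have := is_derive_le_increment (ltW x0x) (c0 _ _) (cE K _ _)
    (fun y _ => is_derive1_const 0 y) (fun y _ => expE K y).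
  rewrite fx0 mul0r subrr sub0r oppr_ge0 pmulr_lle0 ?expR_gt0//; apply => y _.
  rewrite pmulr_lge0 ?expR_gt0//; have := fK y; have := ler_norm (- df y).
  rewrite normrN; lra.
Qed.

End RealDerivatives.

(** * The second-order equation and the roots of [P c] *)

Section Solutions.
Context {R : realType}.
Set Implicit Arguments.
Unset Strict Implicit.
Implicit Types (f u w : R -> R) (c : R * R) (x v L m : R).

Lemma is_derive1_unique f x a b :
  is_derive x 1 f a -> is_derive x 1 f b -> a = b.
Proof. by move=> [_ <-] [_ <-]. Qed.

Lemma smooth_is_derive u n x : smooth u ->
  is_derive x 1 (derive1n n u) (derive1n n.+1 u x).
Proof. by move=> su; rewrite derive1nS derive1E; exact: derivableP. Qed.

(* With [D = u'' - (u^3 - u + c1)], differentiating the equation gives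
   [D u' = 0], differentiating again [D^2 u'' = 0] and [D^3 u''' = 0]; hence
   [(D^4)' = 4 D^3 D' = 0].  So [D] is constant, and it vanishes where
   [u'] does not. *)
Lemma solution_second_order c u : solution c u ->
  (exists x, derive1 u x != 0) ->
  forall x, derive1n 2 u x = u x ^+ 3 - u x + c.1.
Proof.
move=> [su Eu] [x1 ux1].
have d0 x : is_derive x 1 u (derive1n 1 u x) by exact: (smooth_is_derive 0 x su).
have d1 x := smooth_is_derive 1 x su.
have d2 x := smooth_is_derive 2 x su.
have E0 x : derive1n 2 u x * derive1n 1 u x =
    (u x ^+ 3 - u x + c.1) * derive1n 1 u x.
  have lhs := is_derive1_mul (is_derive1_const 2^-1 x) (is_derive1_exp 2 (d1 x)).
  have sq := is_derive1_add (is_derive1_exp 2 (d0 x))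
    (is_derive1_opp (is_derive1_const 1 x)).
  have rhs := is_derive1_add (is_derive1_add
    (is_derive1_mul (is_derive1_const 4^-1 x) (is_derive1_exp 2 sq))
    (is_derive1_mul (is_derive1_const c.1 x) (d0 x)))
    (is_derive1_const c.2 x).
  have eqE : (fun y => 2^-1 * derive1n 1 u y ^+ 2) =
      (fun y => 4^-1 * (u y ^+ 2 - 1) ^+ 2 + c.1 * u y + c.2).
    by apply/funext => y; exact: Eu.
  rewrite eqE in lhs; have := is_derive1_unique lhs rhs.
  by rewrite /= !expr1; lra.
pose D x := derive1n 2 u x - (u x ^+ 3 - u x + c.1).
pose D' x := derive1n 3 u x - (3 * u x ^+ 2 * derive1n 1 u x - derive1n 1 u x).
have dD x : is_derive x 1 D (D' x).
  have := is_derive1_add (d2 x) (is_derive1_opp (is_derive1_add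
    (is_derive1_add (is_derive1_exp 3 (d0 x)) (is_derive1_opp (d0 x)))
    (is_derive1_const c.1 x))).
  by move=> /is_derive_eq; apply; rewrite /D'/=; ring.
have zero f (f' : R -> R) : (forall x, f x = 0) ->
    (forall x, is_derive x 1 f (f' x)) -> forall x, f' x = 0.
  move=> f0 df x; apply: is_derive1_unique (df x) _.
  by rewrite (_ : f = fun=> 0); [exact: is_derive1_const|exact/funext].
have Du1 x : D x * derive1n 1 u x = 0 by rewrite /D mulrBl E0 subrr.
have D2u2 x : D x ^+ 2 * derive1n 2 u x = 0.
  have := zero _ _ Du1 (fun x => is_derive1_mul (dD x) (d1 x)) x.
  (* After multiplication by [D], the term containing [D'] acquires the factor [D u' = 0]; [cancel]
     below repeats the trick one order higher. *)
  move=> /(congr1 ( *%R (D x))); rewrite mulr0 mulrDr => E.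
  rewrite -[RHS]E (_ : D x * (derive1n 1 u x * D' x) =
    D x * derive1n 1 u x * D' x) ?mulrA// Du1; ring.
have D3u3 x : D x ^+ 3 * derive1n 3 u x = 0.
  have := zero _ _ D2u2
    (fun x => is_derive1_mul (is_derive1_exp 2 (dD x)) (d2 x)) x.
  have cancel (a a' b b' : R) : a ^+ 2 * b' + b * (2%:R * a ^+ 1 * a') = 0 ->
      a ^+ 2 * b = 0 -> a ^+ 3 * b' = 0.
    move=> E F; have -> : a ^+ 3 * b' =
      a * (a ^+ 2 * b' + b * (2%:R * a ^+ 1 * a')) - a ^+ 2 * b * (2 * a').
      by ring.
    by rewrite E F; ring.
  by move=> E; exact: cancel E (D2u2 x).
have dD4 x : is_derive x 1 (fun y => D y ^+ 4) 0.
  apply: is_derive_eq (is_derive1_exp 4 (dD x)) _; rewrite /=.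
  have -> : 4%:R * D x ^+ 3 * D' x = 4 * (D x ^+ 3 * derive1n 3 u x) -
      4 * D x ^+ 2 * (3 * u x ^+ 2 - 1) * (D x * derive1n 1 u x).
    by rewrite /D'; ring.
  by rewrite D3u3 Du1; ring.
have Dx1 : D x1 = 0.
  by have /eqP := Du1 x1; rewrite mulf_eq0 => /orP[/eqP//|]; rewrite (negbTE ux1).
move=> x; have := is_derive_0_is_cst x x1 dD4.
rewrite Dx1 expr0n/= => /eqP; rewrite expf_eq0/= => /eqP D0.
by apply/eqP; rewrite -subr_eq0 -/(D x) D0.
Qed.

(** Gronwall for the squared distance [d^2 + e^2] in the phase plane; the common bound [M] makes the
    cubic Lipschitz along both solutions. *)
Lemma second_order_unique (c1 M x0 : R) (u u' w w' : R -> R) :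
  (forall x, is_derive x 1 u (u' x)) ->
  (forall x, is_derive x 1 u' (u x ^+ 3 - u x + c1)) ->
  (forall x, is_derive x 1 w (w' x)) ->
  (forall x, is_derive x 1 w' (w x ^+ 3 - w x + c1)) ->
  (forall x, `|u x| <= M) -> (forall x, `|w x| <= M) ->
  u x0 = w x0 -> u' x0 = w' x0 -> forall x, u x = w x.
Proof.
move=> du du' dw dw' uM wM e0 e1 x.
pose d y := u y - w y; pose e y := u' y - w' y.
pose q y := u y ^+ 2 + u y * w y + w y ^+ 2 - 1.
have dd (y : R) : is_derive y 1 d (e y).
  exact: is_derive1_add (du y) (is_derive1_opp (dw y)).
have de (y : R) : is_derive y 1 e (q y * d y).
  apply: is_derive_eq (is_derive1_add (du' y) (is_derive1_opp (dw' y))) _.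
  by rewrite /q /d; ring.
have dE (y : R) : is_derive y 1 (fun y => d y ^+ 2 + e y ^+ 2)
    (2 * (d y * e y) * (1 + q y)).
  apply: is_derive_eq
    (is_derive1_add (is_derive1_exp 2 (dd y)) (is_derive1_exp 2 (de y))) _.
  by rewrite /= !expr1; ring.
have E0 y : 0 <= d y ^+ 2 + e y ^+ 2 by rewrite addr_ge0// sqr_ge0.
(* [q] is the difference quotient of [v^3 - v], so [1 + q = u^2 + u w + w^2]. *)
have qM y : `|1 + q y| <= 3 * M ^+ 2.
  have := uM y; have := wM y; rewrite !ler_norml /q.
  move=> /andP[? ?] /andP[? ?]; apply/andP; split; nra.
have EK y : `|2 * (d y * e y) * (1 + q y)| <=
    (3 * M ^+ 2) * (d y ^+ 2 + e y ^+ 2).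
  rewrite normrM mulrC ler_pM//; have := sqr_ge0 (d y - e y).
  have := sqr_ge0 (d y + e y); rewrite ler_norml => ? ?; apply/andP; split; nra.
have dx0 : d x0 ^+ 2 + e x0 ^+ 2 = 0.
  by rewrite /d /e e0 e1 !subrr expr0n addr0.
have /eqP := gronwall_eq0 dE E0 EK dx0 x.
by rewrite paddr_eq0 ?sqr_ge0// !sqrf_eq0 subr_eq0 => /andP[/eqP].
Qed.

Lemma P_expand c v : P c v = 2^-1 * (v ^+ 4 - 2 * v ^+ 2 + 4 * c.1 * v + (1 + 4 * c.2)).
Proof. by rewrite /P /W; field. Qed.

(* The quartic [2 P c] is monic, has no cubic term and quadratic coefficient
   [-2]; two roots [m - l], [m + l] determine the remaining factor. *)
Lemma P_factor c m (l : R) : l != 0 -> P c (m - l) = 0 -> P c (m + l) = 0 ->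
  forall v, P c v =
    2^-1 * (l ^+ 2 - (v - m) ^+ 2) * (2 - 2 * m ^+ 2 - l ^+ 2 - (v + m) ^+ 2).
Proof.
move=> l0; rewrite !P_expand => E1 E2 v; rewrite P_expand.
pose B := 2 - 2 * m ^+ 2 - l ^+ 2.
(* [p * v + q] is twice the difference of the two sides, a linear function of [v]; it vanishes at
   [m - l] and [m + l]. *)
pose p := 4 * c.1 - 2 * m * (B - l ^+ 2).
pose q := 1 + 4 * c.2 - (m ^+ 2 - l ^+ 2) * (m ^+ 2 - B).
have pl : p * l = 0 by rewrite /p /B; lra.
have p0 : p = 0 by move/eqP: pl; rewrite mulf_eq0 (negbTE l0) orbF => /eqP.
have q0 : p * m + q = 0 by rewrite /p /q /B; lra.
have {}q0 : q = 0 by move: q0; rewrite p0; lra.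
have c1E : 4 * c.1 = 2 * m * (B - l ^+ 2) by move: p0; rewrite /p; lra.
have c2E : 1 + 4 * c.2 = (m ^+ 2 - l ^+ 2) * (m ^+ 2 - B).
  by move: q0; rewrite /q; lra.
by rewrite c1E c2E /B; field.
Qed.

Lemma zero_mean_solution_nonconstant L c u : zero_mean_solution L c u ->
  exists x, derive1 u x != 0.
Proof.
move=> [[su _] [L0 _ minL] _]; apply: contrapT => /forallNP u0.
have cst x y : u x = u y.
  apply: is_derive_0_is_cst => z.
  have := smooth_is_derive 0 z su; rewrite derive1n1.
  by have /negP := u0 z; rewrite negbK => /eqP ->.
have := minL (L / 2) _ (fun x => cst _ _); rewrite divr_gt0// => /(_ isT).
by rewrite ler_pdivlMr//; lra.
Qed.

Lemma derive1_global_min u x m : smooth u -> u x = m -> lbound (range u) m ->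
  derive1 u x = 0.
Proof.
move=> su uxm um.
have := @derive1_at_min R u (x - 1) (x + 1) x.
rewrite derive1E; move=> H; apply: derive_val; apply: H.
- by rewrite lerD2l; lra.
- by move=> t _; exact: (su 0).
- by rewrite in_itv/=; lra.
- by move=> t _; rewrite uxm; apply: um; exists t.
Qed.

Lemma derive1_global_max u x m : smooth u -> u x = m -> ubound (range u) m ->
  derive1 u x = 0.
Proof.
move=> su uxm um.
have := @derive1_at_max R u (x - 1) (x + 1) x.
rewrite derive1E; move=> H; apply: derive_val; apply: H.
- by rewrite lerD2l; lra.
- by move=> t _; exact: (su 0).
- by rewrite in_itv/=; lra.
- by move=> t _; rewrite uxm; apply: um; exists t.
Qed.

Lemma solution_sqr_derive1 c u x : solution c u -> derive1 u x ^+ 2 = P c (u x).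
Proof. by move=> [_ Eu]; rewrite /P -Eu; field. Qed.

Lemma continuous_attained u um uM v : continuous u ->
  is_min u um -> is_max u uM -> um <= v <= uM -> exists x, u x = v.
Proof.
move=> cu [[x _ <-] _] [[y _ <-] _] uxvy.
have H a b : a <= b -> u a <= v <= u b \/ u b <= v <= u a -> exists z, u z = v.
  move=> ab uv; have [||z _ <-] := @IVT R u a b v ab; last by exists z.
    exact: continuous_subspaceT.
  have [uab|uba] := leP (u a) (u b); case: uv => /andP[? ?]; apply/andP; split; lra.
by have [xy|/ltW yx] := leP x y; [apply: (H _ _ xy); left|apply: (H _ _ yx); right].
Qed.

Lemma smooth_continuous u : smooth u -> continuous u.
Proof. by move=> su x; exact: is_derive_continuous (smooth_is_derive 0 x su). Qed.

(** At a double root [v] in the range, the constant [v] and [u] solve the same second-order equation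
    with the same position and zero velocity at a common point, so [u] would be constant. *)
Lemma solution_no_double_root c u um uM v : solution c u ->
  (exists x, derive1 u x != 0) -> is_min u um -> is_max u uM ->
  um <= v <= uM -> P c v = 0 -> v ^+ 3 - v + c.1 != 0.
Proof.
move=> su u0 umin umax vu Pv; apply/negP => /eqP v0.
have [x0 ux0] := continuous_attained (smooth_continuous su.1) umin umax vu.
have u'x0 : derive1n 1 u x0 = 0.
  by apply/eqP; rewrite -sqrf_eq0 derive1n1 (solution_sqr_derive1 x0 su) ux0 Pv.
have u_le x : `|u x| <= `|um| + `|uM|.
  have /= : um <= u x by apply: umin.2; exists x.
  have /= : u x <= uM by apply: umax.2; exists x.
  have := ler_norm (- um); have := ler_norm uM; rewrite normrN.
  have := normr_ge0 um; have := normr_ge0 uM; rewrite ler_norml.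
  by move=> ? ? ? ? ? ?; apply/andP; split; lra.
have v_le : `|v| <= `|um| + `|uM| by rewrite -ux0.
have d0 x : is_derive x 1 u (derive1n 1 u x) by exact: (smooth_is_derive 0 x su.1).
have d1 x : is_derive x 1 (derive1n 1 u) (u x ^+ 3 - u x + c.1).
  by rewrite -(solution_second_order su u0); exact: (smooth_is_derive 1 x su.1).
have d1v (x : R) : is_derive x 1 (fun=> 0) (v ^+ 3 - v + c.1).
  by rewrite v0; exact: is_derive1_const.
have uE := second_order_unique d0 d1 (is_derive1_const v) d1v u_le (fun=> v_le)
  ux0 u'x0.
have [x /eqP] := u0; apply.
apply: is_derive1_unique (smooth_is_derive 0 x su.1) _ => /=.
by rewrite (_ : u = fun=> v); [exact: is_derive1_const|exact/funext].
Qed.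

(* The last factor is nonnegative on the open range because [P c (u x)] is a
   square; the bounds on [B] are its values at the two ends. *)
Lemma solution_roots c u um uM (m := (um + uM) / 2) (l := (uM - um) / 2)
    (B := 2 - 2 * m ^+ 2 - l ^+ 2) :
  solution c u -> (exists x, derive1 u x != 0) -> is_min u um -> is_max u uM ->
  [/\ 0 < l,
    forall v, P c v = 2^-1 * (l ^+ 2 - (v - m) ^+ 2) * (B - (v + m) ^+ 2),
    (2 * m - l) ^+ 2 <= B & (2 * m + l) ^+ 2 <= B].
Proof.
move=> su u0 umin umax.
have cu := smooth_continuous su.1.
have lt_umM : um < uM.
  rewrite ltNge; apply/negP => uMm; have [x /eqP] := u0; apply.
  apply: is_derive1_unique (smooth_is_derive 0 x su.1) _ => /=.
  rewrite (_ : u = fun=> um); first exact: is_derive1_const.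
  apply/funext => y; apply/eqP; rewrite eq_le.
  rewrite (le_trans (umax.2 (u y) _) uMm)/=; last by exists y.
  by apply: umin.2; exists y.
have umE : um = m - l by rewrite /m /l; field.
have uME : uM = m + l by rewrite /m /l; field.
have l0 : 0 < l by rewrite /l; lra.
have Pm : P c um = 0.
  have [[x _ ux] lu] := umin.
  by rewrite -ux -(solution_sqr_derive1 x su) (derive1_global_min su.1 ux lu) expr0n.
have PM : P c uM = 0.
  have [[x _ ux] lu] := umax.
  by rewrite -ux -(solution_sqr_derive1 x su) (derive1_global_max su.1 ux lu) expr0n.
have PF : forall v, P c v = 2^-1 * (l ^+ 2 - (v - m) ^+ 2) * (B - (v + m) ^+ 2).
  by apply: P_factor; rewrite ?gt_eqF// -?umE -?uME.
have q0 v : um < v < uM -> 0 <= B - (v + m) ^+ 2.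
  move=> /andP[uv vu].
  have [|x ux] := continuous_attained cu umin umax (v := v).
    by rewrite !ltW.
  have := solution_sqr_derive1 x su; rewrite ux PF => E.
  have := sqr_ge0 (derive1 u x); rewrite E pmulr_rge0// pmulr_rgt0 ?invr_gt0//.
  have -> : l ^+ 2 - (v - m) ^+ 2 = (v - um) * (uM - v) by rewrite /l /m; field.
  by rewrite mulr_gt0// subr_gt0.
have end0 (s : R) : `|s| = 1 -> (2 * m + s * l) ^+ 2 <= B.
    move=> s1; rewrite leNgt -subr_gt0; apply/negP.
    set y := _ - B => y0.
    (* Moving from the end [m + s * l] inwards by [e * l] lowers [(v + m)^2] by at most [e * K]. The
       choice of [e] makes this less than the assumed excess [y], so the last factor would be
       negative at an interior point. *)
    pose K := l * (4 * `|m| + 2 * l).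
    have K0 : 0 < K.
      by rewrite mulr_gt0// ltr_wpDl ?mulr_ge0// mulr_gt0.
    pose e := y / (y + K); have yK0 : 0 < y + K by rewrite addr_gt0.
    have e0 : 0 < e by rewrite divr_gt0.
    have e1 : e < 1 by rewrite ltr_pdivrMr// mul1r ltrDl.
    have eK : e * K < y.
      by rewrite /e mulrAC ltr_pdivrMr// ltr_pM2l// ltrDr.
    have /andP[sN s_le1] : -1 <= s <= 1 by rewrite -ler_norml s1.
    have s2 : s ^+ 2 = 1 by rewrite -[LHS]real_normK ?num_real// s1 expr1n.
    have := q0 (m + s * l * (1 - e)); rewrite umE uME.
    have -> : (m - l < m + s * l * (1 - e) < m + l) = true.
      have tN : -1 < s * (1 - e) by nra.
      have t1 : s * (1 - e) < 1 by nra.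
      have lt (t : R) : 0 < t -> 0 < l * t by exact: mulr_gt0.
      have := lt (1 + s * (1 - e)); have := lt (1 - s * (1 - e)).
      by move=> ? ?; apply/andP; split; lra.
    move=> /(_ isT); rewrite leNgt => /negP; apply.
    have msm : s * m <= `|m| by rewrite (le_trans (ler_norm _))// normrM s1 mul1r.
    have : e * (l * (4 * (s * m) + s ^+ 2 * l * (2 - e))) <= e * K.
      rewrite ler_pM2l// ler_pM2l// s2; nra.
    by rewrite -subr_gt0; move: eK; rewrite /y; nra.
  split => //.
    by have := end0 (-1); rewrite normrN1 mulN1r; exact.
  by have := end0 1; rewrite normr1 mul1r; exact.
Qed.

End Solutions.

(** * Integrals singular at the endpoints, and the sign of the moment *)

Section OpenIntervalIntegrals.
Context {R : realType}.
Set Implicit Arguments.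
Unset Strict Implicit.
Implicit Types (f F : R -> R) (a b : R).
Local Notation mu := (@lebesgue_measure R).

Lemma continuous_in_itvoo_measurable f a b :
  {in `]a, b[, continuous f} -> measurable_fun `]a, b[ f.
Proof.
move=> cf; apply: open_continuous_measurable_fun => //.
by move=> x /set_mem; exact: cf.
Qed.

(* [continuous_FTC2] for integrands unbounded at the endpoints. *)
Lemma ge0_continuous_FTC2_oo f F a b : a < b ->
  {in `]a, b[, continuous f} -> (forall x, a < x < b -> 0 <= f x) ->
  F x @[x --> a^'+] --> F a -> F x @[x --> b^'-] --> F b ->
  (forall x, a < x < b -> is_derive x 1 F (f x)) ->
  (\int[mu]_(x in `]a, b[) (f x)%:E = (F b - F a)%:E)%E.
Proof.
move=> ab cf f0 Fa Fb dF.
(* The third keeps every segment [[a + e n, b - e n]] nondegenerate, including the one for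
   [n = 0]. *)
pose e n : R := (b - a) / 3 * harmonic n.
have e0 n : 0 < e n by rewrite mulr_gt0// ?divr_gt0// ?subr_gt0// harmonic_gt0.
have e3 n : e n <= (b - a) / 3.
  rewrite /e /harmonic/= ger_pMr ?divr_gt0// ?subr_gt0//.
  by rewrite invf_le1// ler1n.
have ecvg : e n @[n --> \oo] --> 0.
  rewrite -[X in _ --> X](mulr0 ((b - a) / 3)).
  by apply: cvgM; [exact: cvg_cst|exact: cvg_harmonic].
pose D n : set R := `[a + e n, b - e n]%classic.
have De : nondecreasing_seq D.
  apply/nondecreasing_seqP => n; rewrite /D; apply/subsetPset => x /=.
  have : e n.+1 <= e n.
    by rewrite /e ler_pM2l ?divr_gt0 ?subr_gt0// /harmonic/= lef_pV2 ?posrE// ler_nat.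
  by rewrite !in_itv/= => ? /andP[? ?]; apply/andP; split; lra.
have DE : \bigcup_n D n = `]a, b[%classic.
  apply/seteqP; split => x /=.
    move=> [n _]; rewrite /D/= !in_itv/= => /andP[? ?]; have := e0 n.
    by move=> ?; apply/andP; split; lra.
  rewrite in_itv/= => /andP[ax xb].
  have m0 : 0 < Num.min (x - a) (b - x) by rewrite lt_min !subr_gt0 ax.
  have [N _ /(_ N (leqnn N))/=] := cvgr_lt 0 ecvg _ m0.
  rewrite lt_min => /andP[? ?]; exists N => //; rewrite /D/= in_itv/=.
  by apply/andP; split; lra.
have /measurable_EFinP mf := continuous_in_itvoo_measurable cf.
have Dab n : D n `<=` `]a, b[ by rewrite -DE; exact: bigcup_sup.
have c1 : (\int[mu]_(x in D n) (f x)%:E)%E @[n --> \oo] -->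
    (\int[mu]_(x in `]a, b[) (f x)%:E)%E.
  rewrite -DE; apply: ge0_nondecreasing_set_cvg_integral => //.
  - by move=> n; exact: measurable_itv.
  - by move=> n; apply: measurable_funS mf => //; exact: Dab.
  - by move=> n x /Dab; rewrite /= in_itv/= lee_fin; exact: f0.
have c2 : (\int[mu]_(x in D n) (f x)%:E)%E @[n --> \oo] --> (F b - F a)%:E.
  rewrite (_ : (fun n => _) = (fun n => (F (b - e n) - F (a + e n))%:E)); last first.
    apply/funext => n; have := e3 n => e3n; have e0n := e0 n.
    have abn : a + e n < b - e n by lra.
    have inn x : x \in `[a + e n, b - e n] -> a < x < b.
      by rewrite in_itv/= => /andP[? ?]; apply/andP; split; lra.
    rewrite (@continuous_FTC2 _ f F)//.
    - apply: continuous_in_subspaceT => x; rewrite inE => /inn xab.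
      by apply: cf; rewrite in_itv.
    - split.
      + move=> x /subset_itv_oo_cc /inn xab; by case: (dF x xab).
      + apply: cvg_at_right_filter; apply: is_derive_continuous (dF _ _).
        by apply: inn; rewrite in_itv/= lexx ltW.
      + apply: cvg_at_left_filter; apply: is_derive_continuous (dF _ _).
        by apply: inn; rewrite in_itv/= lexx ltW.
    - move=> x /subset_itv_oo_cc /inn xab; rewrite derive1E.
      by case: (dF x xab).
  apply: cvg_EFin; first by near=> n.
  apply: cvgB.
  - apply: (proj1 (cvg_at_leftP F b (F b)) Fb) => //; split.
      by move=> n; rewrite ltrBlDr ltrDl.
    by rewrite -[X in _ --> X]subr0; apply: cvgB => //; exact: cvg_cst.
  - apply: (proj1 (cvg_at_rightP F a (F a)) Fa) => //; split.
      by move=> n; rewrite ltrDl.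
    by rewrite -[X in _ --> X]addr0; apply: cvgD => //; exact: cvg_cst.
exact: cvg_unique c1 c2.
Unshelve. all: by end_near. Qed.

(** A zero integral would make [f] vanish almost everywhere, placing an interval of positive length
    inside a null set. *)
Lemma integral_gt0_itvoo f a b : a < b -> {in `]a, b[, continuous f} ->
  (forall x, a < x < b -> 0 < f x) ->
  (\int[mu]_(x in `]a, b[) (f x)%:E != 0)%E.
Proof.
move=> ab cf f0; apply/eqP => int0.
have /measurable_EFinP mf := continuous_in_itvoo_measurable cf.
have : (\int[mu]_(x in `]a, b[) `|(f x)%:E| = 0)%E.
  rewrite -int0; apply: eq_integral => x; rewrite inE/= in_itv/= => xab.
  by rewrite ger0_norm// ltW// f0.
move=> /(proj1 (ae_eq_integral_abs mu (measurable_itv _) mf)) [N [mN N0 abN]].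
have : (mu `]a, b[ <= mu N)%E.
  apply: le_measure; rewrite ?inE//.
  move=> x xab; apply: abN => /=; apply/not_implyP; split => //.
  by move=> [] /eqP; rewrite gt_eqF// f0.
rewrite N0 lebesgue_measure_itv/= lte_fin ab -EFinD lee_fin.
by rewrite subr_le0 leNgt ab.
Qed.

(** As [+oo - +oo = -oo], the value 0 forces both parts to be finite. This turns the zero-mean
    condition into integrability, which is required before the comparison integral can be
    subtracted. *)
Lemma integral0_integrable f a b : {in `]a, b[, continuous f} ->
  (\int[mu]_(x in `]a, b[) (f x)%:E = 0)%E ->
  mu.-integrable `]a, b[ (EFin \o f).
Proof.
move=> cf; rewrite integralE => int0.
have /measurable_EFinP mf := continuous_in_itvoo_measurable cf.
apply/integrableP; split => //.
have -> : (fun x => `|(EFin \o f) x|)%E = ((EFin \o f)^\+ \+ (EFin \o f)^\-)%E.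
  by rewrite -fune_abse.
rewrite ge0_integralD//; last 2 first.
- exact: measurable_funepos.
- exact: measurable_funeneg.
have : (0 <= \int[mu]_(x in `]a, b[) (EFin \o f)^\+ x)%E by exact: integral_ge0.
have : (0 <= \int[mu]_(x in `]a, b[) (EFin \o f)^\- x)%E by exact: integral_ge0.
move: int0; case: (\int[mu]_(x in _) _)%E => [p| |] //.
by case: (\int[mu]_(x in _) _)%E => [q| |] //; rewrite -EFinD ltry.
by case: (\int[mu]_(x in _) _)%E => [q| |].
Qed.

Lemma integral_itvoo_split (k : R -> \bar R) a m b : a < m < b ->
  measurable_fun `]a, b[ k ->
  (\int[mu]_(v in `]a, b[) k v =
   \int[mu]_(v in `]a, m[) k v + \int[mu]_(v in `]m, b[) k v)%E.
Proof.
move=> /andP[am mb] mk.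
have abE : `]a, b[%classic = `]a, m] `|` `]m, b[ :> set R.
  by rewrite -itv_bndbnd_setU// bnd_simp// ltW.
rewrite (@integral_itv_bndo_bndc _ (BRight a) m); last first.
  apply: measurable_funS mk => // x /=; rewrite !in_itv/= => /andP[-> xm]/=.
  exact: lt_trans mb.
rewrite abE in mk *; apply: integral_setU => //.
apply/disj_setPS => x [] /=; rewrite !in_itv/= => /andP[_ xm] /andP[mx _].
by move: mx; rewrite ltNge xm.
Qed.

(* With [w = v - m], a primitive is
   [- sqrt 2 * ln (sqrt (l ^+ 2 - w ^+ 2) + sqrt (A - w ^+ 2))]. *)
Lemma odd_arcsine_kernel_integral0 (l A : R) (m : R)
    (h := fun v : R => (v - m) /
      Num.sqrt (2^-1 * (l ^+ 2 - (v - m) ^+ 2) * (A - (v - m) ^+ 2))) :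
  0 < l -> l ^+ 2 < A ->
  mu.-integrable `](m - l)%R, (m + l)%R[ (EFin \o h) /\
  (\int[mu]_(v in `](m - l)%R, (m + l)%R[) (h v)%:E = 0)%E.
Proof.
move=> l0 lA.
pose K := (Num.sqrt 2^-1 : R)^-1.
pose X (v : R) : R := l ^+ 2 - (v - m) ^+ 2; pose Z (v : R) : R := A - (v - m) ^+ 2.
pose G (v : R) : R := - K * ln (Num.sqrt (X v) + Num.sqrt (Z v)).
have X0 (v : R) : m - l < v < m + l -> 0 < X v.
  move=> /andP[? ?]; rewrite /X (_ : _ - _ = (v - (m - l)) * (m + l - v)).
    by rewrite mulr_gt0// subr_gt0.
  by ring.
have Z0 (v : R) : m - l <= v <= m + l -> 0 < Z v.
  move=> /andP[? ?]; have -> : Z v = (A - l ^+ 2) + (v - (m - l)) * (m + l - v).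
    by rewrite /Z; ring.
  by rewrite ltr_wpDr ?subr_gt0// mulr_ge0// subr_ge0.
have dX (v : R) : is_derive v 1 X (- 2 * (v - m)).
  apply: is_derive_eq (is_derive1_add (is_derive1_const _ _) (is_derive1_opp
    (is_derive1_exp 2 (is_derive1_add (is_derive1_id _)
    (is_derive1_opp (is_derive1_const m v)))))) _.
  by rewrite /=; ring.
have dZ (v : R) : is_derive v 1 Z (- 2 * (v - m)).
  apply: is_derive_eq (is_derive1_add (is_derive1_const _ _) (is_derive1_opp
    (is_derive1_exp 2 (is_derive1_add (is_derive1_id _)
    (is_derive1_opp (is_derive1_const m v)))))) _.
  by rewrite /=; ring.
(* At the ends [X] vanishes but [Z] stays positive, so the argument of [ln] does not reach 0. *)
have Gc (v : R) : m - l <= v <= m + l -> {for v, continuous G}.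
  move=> vml; apply: continuousM; first exact: cst_continuous.
  apply: (@continuous_comp _ _ _ (fun v => Num.sqrt (X v) + Num.sqrt (Z v)) (@ln R)).
    apply: continuousD; apply: continuous_comp; try exact: sqrt_continuous.
      exact: is_derive_continuous (dX v).
    exact: is_derive_continuous (dZ v).
  by apply: continuous_ln; rewrite ltr_wpDl ?sqrtr_ge0// sqrtr_gt0 Z0.
have hE (v : R) : m - l < v < m + l ->
    h v = K * (v - m) / (Num.sqrt (X v) * Num.sqrt (Z v)).
  move=> vml; have := ltW (X0 v vml) => Xv0.
  rewrite /h -/(X v) -/(Z v) sqrtrM ?mulr_ge0// sqrtrM//.
  by rewrite !invfM /K; ring.
have dG (v : R) : m - l < v < m + l -> is_derive v 1 G (h v).
  move=> vml; have Xv0 := X0 v vml.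
  have Zv0 : 0 < Z v by apply: Z0; move/andP: vml => [/ltW -> /ltW ->].
  have S0 : 0 < Num.sqrt (X v) + Num.sqrt (Z v) by rewrite addr_gt0 ?sqrtr_gt0.
  have dS := is_derive1_add (is_derive1_chain (is_derive1_sqrt Xv0) (dX v))
    (is_derive1_chain (is_derive1_sqrt Zv0) (dZ v)).
  have dl := @is_derive1_chain _ _ (fun v => Num.sqrt (X v) + Num.sqrt (Z v))
    _ _ _ (is_derive1_ln S0) dS.
  apply: is_derive_eq (is_derive1_mul (is_derive1_const (- K) v) dl) _.
  rewrite hE//= mulr0 addr0; field.
  by rewrite !gt_eqF ?sqrtr_gt0.
have hc v : m - l < v < m + l -> {for v, continuous h}.
  move=> vml; have Xv0 := X0 v vml.
  have Zv0 : 0 < Z v by apply: Z0; move/andP: vml => [/ltW -> /ltW ->].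
  have XZ0 : 0 < 2^-1 * X v * Z v by rewrite !mulr_gt0.
  have dXZ := is_derive1_mul (is_derive1_mul (is_derive1_const 2^-1 v) (dX v)) (dZ v).
  have ds := @is_derive1_chain _ _ (fun v => 2^-1 * X v * Z v) _ _ _
    (is_derive1_sqrt XZ0) dXZ.
  have dm := is_derive1_add (is_derive1_id v) (is_derive1_opp (is_derive1_const m v)).
  apply: continuousM; first exact: is_derive_continuous dm.
  apply: continuousV; last exact: is_derive_continuous ds.
  by rewrite gt_eqF// sqrtr_gt0.
have GE : G (m + l) = G (m - l).
  by rewrite /G /X /Z; congr (_ * ln (Num.sqrt _ + Num.sqrt _)); ring.
have Gleft (a b : R) : m - l <= a -> b <= m + l -> a < b ->
    G x @[x --> a^'+] --> G a /\ G x @[x --> b^'-] --> G b.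
  move=> la bl ab; split.
    by apply: cvg_at_right_filter; apply: Gc; rewrite la (le_trans (ltW ab)).
  by apply: cvg_at_left_filter; apply: Gc; rewrite bl (le_trans la (ltW ab)).
(* [h] changes sign at [m], while the fundamental theorem above needs a nonnegative integrand: each
   half is treated alone, and the two finite values cancel by [GE]. *)
have int_left : (\int[mu]_(v in `](m - l)%R, m[) (- h v)%:E = (G (m - l) - G m)%:E)%E.
  have [|||Ga Gb] := Gleft (m - l) m; rewrite ?lexx// ?lerDl ?gtrBl ?ltW//.
  have -> : G (m - l) - G m = - G m - - G (m - l) by ring.
  have vml v : m - l < v < m -> m - l < v < m + l.
    by move=> /andP[-> /lt_trans]; apply; rewrite ltrDl.
  apply: (@ge0_continuous_FTC2_oo (fun v => - h v) (fun v => - G v)).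
  - by rewrite gtrBl.
  - move=> v; rewrite in_itv/= => /vml /hc; exact: continuousN.
  - move=> v mv; rewrite hE ?vml// -mulNr divr_ge0 ?mulr_ge0 ?sqrtr_ge0//.
    rewrite -mulrN mulr_ge0 ?invr_ge0 ?sqrtr_ge0//.
    by rewrite oppr_ge0 subr_le0; move/andP: mv => [_ /ltW].
  - exact: cvgN.
  - exact: cvgN.
  - move=> v /vml /dG; exact: is_deriveN.
have int_right : (\int[mu]_(v in `]m, (m + l)%R[) (h v)%:E = (G (m + l) - G m)%:E)%E.
  have [|||Ga Gb] := Gleft m (m + l); rewrite ?lexx// ?gerBl ?ltrDl ?ltW//.
  have vml v : m < v < m + l -> m - l < v < m + l.
    by move=> /andP[mv ->]; rewrite andbT (lt_trans _ mv)// gtrBl.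
  apply: (@ge0_continuous_FTC2_oo h G).
  - by rewrite ltrDl.
  - by move=> v; rewrite in_itv/= => /vml /hc.
  - move=> v mv; rewrite hE ?vml// divr_ge0 ?mulr_ge0 ?sqrtr_ge0//.
      by rewrite invr_ge0 sqrtr_ge0.
    by rewrite subr_ge0; move/andP: mv => [/ltW].
  - exact: Ga.
  - exact: Gb.
  - by move=> v /vml /dG.
have ml : m - l < m < m + l by rewrite gtrBl ltrDl l0.
have /measurable_EFinP mh : measurable_fun `](m - l)%R, (m + l)%R[ h.
  by apply: continuous_in_itvoo_measurable => v; rewrite in_itv/=; exact: hc.
have nh v : m - l < v < m -> h v <= 0.
  move=> /andP[lv vm]; rewrite /h -oppr_ge0 -mulNr mulr_ge0 ?invr_ge0 ?sqrtr_ge0//.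
  by rewrite oppr_ge0 subr_le0 ltW.
have ph v : m < v < m + l -> 0 <= h v.
  move=> /andP[mv vl]; rewrite /h mulr_ge0 ?invr_ge0 ?sqrtr_ge0//.
  by rewrite subr_ge0 ltW.
split.
  apply/integrableP; split => //.
  rewrite (integral_itvoo_split ml); last exact: measurableT_comp.
  rewrite (@eq_integral _ _ _ mu _ (fun v => (- h v)%:E)); last first.
    by move=> v; rewrite inE/= in_itv/= => vm; rewrite ler0_norm// nh.
  rewrite (@eq_integral _ _ _ mu `]m, (m + l)[ (fun v => (h v)%:E)); last first.
    by move=> v; rewrite inE/= in_itv/= => vm; rewrite ger0_norm// ph.
  by rewrite int_left int_right -EFinD ltry.
rewrite (integral_itvoo_split ml)// int_right.
have -> : (\int[mu]_(v in `](m - l)%R, m[) (h v)%:E =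
    - \int[mu]_(v in `](m - l)%R, m[) (- h v)%:E)%E.
  rewrite -integral_ge0N; first by apply: eq_integral => v _; rewrite EFinN oppeK.
  by move=> v /=; rewrite in_itv/= lee_fin oppr_ge0; exact: nh.
by rewrite int_left GE -EFinN -EFinD; congr _%:E; ring.
Qed.

Lemma is_derive1_P (c : R * R) (v : R) : is_derive v 1 (P c) (2 * (v ^+ 3 - v + c.1)).
Proof.
rewrite (_ : P c = fun v => 2 * (4^-1 * (v ^+ 2 - 1) ^+ 2 + c.1 * v + c.2))//.
have dv := is_derive1_id v.
have dsq := is_derive1_add (is_derive1_exp 2 dv)
  (is_derive1_opp (is_derive1_const 1 v)).
have dW := is_derive1_mul (is_derive1_const 4^-1 v) (is_derive1_exp 2 dsq).
have dl := is_derive1_mul (is_derive1_const c.1 v) dv.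
have dP := is_derive1_add (is_derive1_add dW dl) (is_derive1_const c.2 v).
apply: is_derive_eq (is_derive1_mul (is_derive1_const 2 v) dP) _.
by rewrite /=; field.
Qed.

Lemma continuous_P (c : R * R) : continuous (P c).
Proof. by move=> v; exact: is_derive_continuous (is_derive1_P c v). Qed.

(* With [w = v - m], the integrand exceeds [w / sqrt (X Z / 2)] (for [m > 0]),
   where [X = l^2 - w^2] and [Z = B - 4 m^2 - w^2]: the sign of
   [(w + 2 m)^2 - (4 m^2 + w^2)] is that of [m w]. *)
Lemma moment_integral_eq0_centered (c : R * R) (m l B : R) : 0 < l ->
  (forall v, P c v = 2^-1 * (l ^+ 2 - (v - m) ^+ 2) * (B - (v + m) ^+ 2)) ->
  (2 * m - l) ^+ 2 <= B -> (2 * m + l) ^+ 2 <= B ->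
  moment_integral c (m - l) (m + l) = 0%E -> m = 0.
Proof.
move=> l0 PF B1 B2 int0; apply/eqP/negPn/negP => m0.
have m2 : 0 < m ^+ 2 by rewrite lt_def sqrf_eq0 m0 sqr_ge0.
pose A := B - 4 * m ^+ 2.
(* The end bound on the side of the sign of [m] gives [A >= l^2 + 4 |m| l]. *)
have lA : l ^+ 2 < A by rewrite /A; have [|] := leP 0 m => ?; nra.
have [ih inth] := odd_arcsine_kernel_integral0 m l0 lA.
move: ih inth; set h := (fun v => _ / _) => ih inth.
pose f (v : R) : R := v / Num.sqrt (P c v).
pose X (v : R) : R := l ^+ 2 - (v - m) ^+ 2.
pose Y (v : R) : R := B - (v + m) ^+ 2.
pose Z (v : R) : R := A - (v - m) ^+ 2.
have X0 (v : R) : m - l < v < m + l -> 0 < X v.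
  move=> /andP[? ?]; rewrite /X (_ : _ - _ = (v - (m - l)) * (m + l - v)).
    by rewrite mulr_gt0// subr_gt0.
  by ring.
have Y0 (v : R) : m - l < v < m + l -> 0 < Y v.
  move=> vml; have := X0 v vml; move/andP: vml => [? ?]; rewrite /Y /X.
  by nra.
have Z0 (v : R) : m - l < v < m + l -> 0 < Z v.
  by move=> /X0; rewrite /X /Z; move: lA; lra.
have P0 (v : R) : m - l < v < m + l -> 0 < P c v.
  by move=> vml; rewrite PF !mulr_gt0 ?X0 ?Y0.
have fc : {in `]m - l, m + l[, continuous f}.
  move=> v; rewrite in_itv/= => vml.
  apply: (@continuousM R R id (fun v => (Num.sqrt (P c v))^-1)).
    exact: is_derive_continuous (is_derive1_id v).
  apply: continuousV; first by rewrite gt_eqF// sqrtr_gt0 P0.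
  apply: continuous_comp; last exact: sqrt_continuous.
  exact: continuous_P.
have hc : {in `]m - l, m + l[, continuous h}.
  move=> v; rewrite in_itv/= => vml; have XZ0 : 0 < 2^-1 * X v * Z v.
    by rewrite !mulr_gt0// ?X0// Z0.
  have dw := is_derive1_add (is_derive1_id v) (is_derive1_opp (is_derive1_const m v)).
  have dX := is_derive1_add (is_derive1_const (l ^+ 2) v)
    (is_derive1_opp (is_derive1_exp 2 dw)).
  have dZ := is_derive1_add (is_derive1_const A v)
    (is_derive1_opp (is_derive1_exp 2 dw)).
  have dXZ := is_derive1_mul (is_derive1_mul (is_derive1_const 2^-1 v) dX) dZ.
  have ds := @is_derive1_chain _ _ (fun v => 2^-1 * X v * Z v) _ _ _
    (is_derive1_sqrt XZ0) dXZ.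
  apply: (@continuousM R R (fun v => v - m) (fun v => (Num.sqrt (2^-1 * X v * Z v))^-1)).
    exact: is_derive_continuous dw.
  apply: continuousV; last exact: is_derive_continuous ds.
  by rewrite gt_eqF// sqrtr_gt0.
have if_ := integral0_integrable fc int0; rewrite /moment_integral -/f in int0.
(* The factor [m] treats both signs of [m] at once. *)
have : (\int[mu]_(v in `](m - l)%R, (m + l)%R[) (m * (f v - h v))%:E = 0)%E.
  under eq_integral do rewrite EFinM EFinB.
  rewrite integralZl//; last exact: integrableB.
  by rewrite integralB_EFin// inth [X in (_ * (X - _))%E]int0 sube0 mule0.
apply/eqP; apply: integral_gt0_itvoo.
- by rewrite ltrD2l gtrN.
- move=> v vml; apply: (@continuousM R R (cst m) (f - h)); first exact: cst_continuous.
  by apply: continuousB; [exact: fc|exact: hc].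
move=> v vml; have Xv := X0 v vml; have Yv := Y0 v vml; have Zv := Z0 v vml.
rewrite /f /h PF -/(X v) -/(Y v) -/(Z v).
set p := (Num.sqrt (2^-1 * X v * Y v))^-1.
set q := (Num.sqrt (2^-1 * X v * Z v))^-1.
have p0 : 0 < p by rewrite invr_gt0 sqrtr_gt0 !mulr_gt0.
have q0 : 0 < q by rewrite invr_gt0 sqrtr_gt0 !mulr_gt0.
have le_inv (y z : R) : 0 < y -> y <= z ->
    (Num.sqrt (2^-1 * X v * z))^-1 <= (Num.sqrt (2^-1 * X v * y))^-1.
  move=> y0 yz; have z0 := lt_le_trans y0 yz.
  rewrite lef_pV2 ?posrE ?sqrtr_gt0 ?mulr_gt0//.
  by rewrite ler_wsqrtr// ler_pM2l ?mulr_gt0.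
(* Since [Y v - Z v = - 4 m (v - m)], the difference [p - q] has the sign of [m (v - m)], so the
   last summand is nonnegative and the first is positive. *)
have -> : m * (v * p - (v - m) * q) = m ^+ 2 * p + m * (v - m) * (p - q) by ring.
apply: ltr_pwDl; first by rewrite mulr_gt0.
have [mw|/ltW mw] := leP 0 (m * (v - m)).
  apply: mulr_ge0 => //; rewrite subr_ge0; apply: le_inv => //.
  by rewrite /Y /Z /A; nra.
apply: mulr_le0 => //; rewrite subr_le0; apply: le_inv => //.
by rewrite /Y /Z /A; nra.
Qed.

End OpenIntervalIntegrals.

(** * Primitives on the whole line and inverse functions *)

Section Primitives.
Context {R : realType}.
Set Implicit Arguments.
Unset Strict Implicit.
Implicit Types (f : R -> R) (a b x y : R).
Local Notation mu := (@lebesgue_measure R).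

Lemma is_derive_integral f a x : continuous f -> a < x ->
  is_derive x 1 (fun y => \int[mu]_(t in `[a, y]) f t)%R (f x).
Proof.
move=> cf ax.
have [||||d e] := @continuous_FTC1_closed R f a x (x + 1).
- by rewrite ltrDl.
- by apply: continuous_compact_integrable;
    [exact: segment_compact|exact: continuous_subspaceT].
- exact: ax.
- exact: cf.
by split; [exact: d|rewrite -derive1E; exact: e].
Qed.

(** The integral from [-1] has the right derivative only to the right of [-1]; its mirror image
    covers [x < 1]. After normalisation at 0 the two agree on the overlap and are glued there.
    Continuity stays inside the existential so that [primitive] can be chosen for every [f]. *)
Lemma ex_primitive f : exists F : R -> R,
  continuous f -> forall x, is_derive x 1 F (f x).
Proof.
pose A x := (\int[mu]_(t in `[-1, x]) f t)%R.
pose B x := (\int[mu]_(t in `[-1, x]) f (- t))%R.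
pose F x := if 0 <= x then A x - A 0 else B 0 - B (- x).
exists F => cf x.
have cfN : continuous (fun t => f (- t)).
  by move=> t; apply: continuous_comp; [exact: opp_continuous|exact: cf].
have dA y : -1 < y -> is_derive y 1 A (f y) by exact: is_derive_integral.
have dB y : y < 1 -> is_derive y 1 (fun z => B (- z)) (- f y).
  move=> y1; have /(is_derive_integral cfN) dBy : -1 < - y by rewrite ltrN2.
  apply: is_derive_eq (is_derive1_chain dBy (is_derive1_opp (is_derive1_id y))) _.
  by rewrite opprK mulrN1.
have AB y : -1 < y < 1 -> A y - A 0 = B 0 - B (- y).
  move=> /andP[Ny y1].
  have H a b : -1 < a -> b < 1 -> a <= b -> A b + B (- b) = A a + B (- a).
    move=> a1 b1 ab; have dAB z : a <= z <= b ->
        is_derive z 1 (fun z => A z + B (- z)) 0.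
      move=> /andP[az zb].
      apply: is_derive_eq (is_derive1_add (dA z _) (dB z _)) (subrr _).
        exact: lt_le_trans az.
      exact: le_lt_trans b1.
    have cAB := is_derive_segment_continuous dAB.
    have c0 := is_derive_segment_continuous
      (fun z (_ : a <= z <= b) => is_derive1_const 0 z).
    have sub z : a < z < b -> a <= z <= b by move=> /andP[/ltW -> /ltW ->].
    have := is_derive_le_increment ab cAB c0 (fun z h => dAB z (sub z h))
      (fun z _ => is_derive1_const 0 z) (fun _ _ => lexx 0).
    have := is_derive_le_increment ab c0 cAB (fun z _ => is_derive1_const 0 z)
      (fun z h => dAB z (sub z h)) (fun _ _ => lexx 0).
    by lra.
  have [y0|/ltW y0] := leP 0 y.
    by have := H 0 y; rewrite oppr0 ltrN10 y1 y0 => /(_ isT isT isT); lra.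
  by have := H y 0; rewrite oppr0 ltr01 Ny y0 => /(_ isT isT isT); lra.
have dA0 y : -1 < y -> is_derive y 1 (fun y => A y - A 0) (f y).
  move=> y1; apply: is_derive_eq (is_derive1_add (dA y y1)
    (is_derive1_opp (is_derive1_const (A 0) y))) _.
  by rewrite oppr0 addr0.
have dB0 y : y < 1 -> is_derive y 1 (fun y => B 0 - B (- y)) (f y).
  move=> y1; apply: is_derive_eq (is_derive1_add (is_derive1_const (B 0) y)
    (is_derive1_opp (dB y y1))) _.
  by rewrite opprK add0r.
have [x1|x1] := ltP (- (1 / 2)) x.
  apply: near_eq_is_derive (dA0 x _); last by lra.
  near=> y; rewrite /F; case: ifPn => //; rewrite -ltNge => y0; apply: AB.
  apply/andP; split; last by lra.
  by apply: (@lt_trans _ _ (- (1/2))); [lra|near: y; exact: lt_nbhsr].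
apply: near_eq_is_derive (dB0 x _); last by lra.
near=> y; rewrite /F; case: ifPn => // y0; suff : y < 0 by lra.
by near: y; apply: lt_nbhsl; lra.
Unshelve. all: by end_near. Qed.

Definition primitive f : R -> R := sval (cid (ex_primitive f)).

Lemma is_derive_primitive f x : continuous f -> is_derive x 1 (primitive f) (f x).
Proof. by rewrite /primitive; case: cid => F /= HF cf; exact: HF. Qed.

Lemma is_derive_lt_increment (f g df dg : R -> R) a b : a < b ->
  (forall x, is_derive x 1 f (df x)) -> (forall x, is_derive x 1 g (dg x)) ->
  (forall x, a < x < b -> df x < dg x) -> f b - f a < g b - g a.
Proof.
move=> ab dF dG fg.
have dh x := is_derive1_add (dG x) (is_derive1_opp (dF x)).
have [|c] := MVT ab (fun x _ => dh x).
  exact: (is_derive_segment_continuous (fun x _ => dh x)).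
rewrite in_itv/= => cab E; have : 0 < (dg c - df c) * (b - a).
  by rewrite mulr_gt0// subr_gt0// fg.
by rewrite -E; lra.
Qed.

Lemma is_derive_le_incrementT (f g df dg : R -> R) a b : a <= b ->
  (forall x, is_derive x 1 f (df x)) -> (forall x, is_derive x 1 g (dg x)) ->
  (forall x, a < x < b -> df x <= dg x) -> f b - f a <= g b - g a.
Proof.
move=> ab dF dG fg; apply: (is_derive_le_increment ab) (fun x _ => dF x)
    (fun x _ => dG x) fg.
  exact: (is_derive_segment_continuous (fun x _ => dF x)).
exact: (is_derive_segment_continuous (fun x _ => dG x)).
Qed.

(** A derivative of at least 1 gives strict growth and at least linear escape in both directions,
    hence a bijection of the line. *)
Lemma ex_inverse_derivative (F f : R -> R) :
  (forall x, is_derive x 1 F (f x)) -> (forall x, 1 <= f x) ->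
  exists G : R -> R, [/\ cancel F G, cancel G F, {mono F : x y / x < y} &
    forall x, is_derive x 1 G (f (G x))^-1].
Proof.
move=> dF f1.
have cF : continuous F by move=> x; exact: is_derive_continuous (dF x).
have F_lt x y : x < y -> F x < F y.
  move=> xy; rewrite -subr_gt0.
  have := is_derive_le_incrementT (ltW xy) is_derive1_id dF (fun x _ => f1 x).
  by apply: lt_le_trans; rewrite subr_gt0.
have Finj : {mono F : x y / x < y} by exact: leW_mono (le_mono F_lt).
have surj y : exists x, F x = y.
  (* Over [[- c, 0]] and over [[0, c]] the function rises by at least [c], so [[- c, c]] already
     yields the value [y]. *)
  pose c := `|y - F 0|.
  have c0 : 0 <= c by exact: normr_ge0.
  have := is_derive_le_incrementT c0 is_derive1_id dF (fun x _ => f1 x).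
  have Nc0 : - c <= 0 by rewrite oppr_le0.
  have := is_derive_le_incrementT Nc0 is_derive1_id dF (fun x _ => f1 x).
  have := ler_norm (y - F 0); have := ler_norm (- (y - F 0)); rewrite normrN -/c.
  move=> h1 h2 h3 h4.
  have [|||x _ <-] := @IVT R F (- c) c y; last by exists x.
  - by lra.
  - exact: continuous_subspaceT.
  - by rewrite ge_min le_max; apply/andP; split; apply/orP; [left|right]; lra.
have [G GK] := choice surj.
have FK : cancel F G.
  move=> x; have := GK (F x).
  by case: (ltgtP (G (F x)) x) => // /F_lt /[swap] ->; rewrite ltxx.
exists G; split => // x.
have := @is_derive_inverse R F G (f (G x)) (G x) _ _ (dF (G x)) _.
rewrite GK; apply.
- by near=> y; exact: FK.
- by near=> y; exact: cF.
- by rewrite gt_eqF// (lt_le_trans _ (f1 _)).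
Unshelve. all: by end_near. Qed.

End Primitives.

(** * The period as a function of the squared amplitude [k] *)

Section HalfPeriod.
Context {R : realType}.
Set Implicit Arguments.
Unset Strict Implicit.
Implicit Types (k x y : R).

(* The symmetric solution with maximum [sqrt k] is [sqrt k * sin phi], where the
   amplitude solves [phi' = amp_speed k phi]. *)
Definition amp_speed k x : R := Num.sqrt (1 - k / 2 * (1 + sin x ^+ 2)).

Definition amp_time k : R -> R := primitive (fun x => (amp_speed k x)^-1).

(** The travel time from minimum to maximum. For [0 <= k < 1] it is [2 / sqrt (1 - k / 2)] times the
    complete elliptic integral of the first kind with parameter [k / (2 - k)]. *)
Definition half_period k : R := amp_time k (pi / 2) - amp_time k (- (pi / 2)).

Lemma sqr_sin_le1 x : sin x ^+ 2 <= 1.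
Proof. by rewrite -(cos2Dsin2 x) lerDr sqr_ge0. Qed.

Lemma amp_speed_radicand k x : 0 <= k ->
  1 - k <= 1 - k / 2 * (1 + sin x ^+ 2) <= 1 - k / 2.
Proof.
by move=> k0; have := sqr_sin_le1 x; have := sqr_ge0 (sin x);
  move=> ? ?; apply/andP; split; nra.
Qed.

Lemma amp_speed_gt0 k x : 0 <= k < 1 -> 0 < amp_speed k x.
Proof.
move=> /andP[k0 k1]; rewrite sqrtr_gt0.
by have /andP[+ _] := amp_speed_radicand x k0; apply: lt_le_trans; rewrite subr_gt0.
Qed.

Lemma amp_speed_le1 k x : 0 <= k < 1 -> amp_speed k x <= 1.
Proof.
move=> /andP[k0 k1]; rewrite /amp_speed -[leRHS]sqrtr1 ler_wsqrtr//.
by have /andP[_] := amp_speed_radicand x k0; lra.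
Qed.

Lemma amp_speed_inv_ge1 k x : 0 <= k < 1 -> 1 <= (amp_speed k x)^-1.
Proof. by move=> kP; rewrite invf_ge1 ?amp_speed_gt0// amp_speed_le1. Qed.

Lemma sqr_amp_speed k x : 0 <= k < 1 ->
  amp_speed k x ^+ 2 = 1 - k / 2 * (1 + sin x ^+ 2).
Proof.
move=> /andP[k0 k1]; rewrite sqr_sqrtr//.
by have /andP[+ _] := amp_speed_radicand x k0; apply: le_trans; rewrite subr_ge0 ltW.
Qed.

Lemma is_derive_amp_speed k x : 0 <= k < 1 ->
  is_derive x 1 (amp_speed k) (- (k / 2) * (sin x * cos x) / amp_speed k x).
Proof.
move=> kP; have := amp_speed_gt0 x kP => s0; have := s0; rewrite sqrtr_gt0 => r0.
have dr := is_derive1_add (is_derive1_const 1 x) (is_derive1_opp (is_derive1_mul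
  (is_derive1_const (k / 2) x) (is_derive1_add (is_derive1_const 1 x)
  (is_derive1_exp 2 (is_derive_sin x))))).
have := @is_derive1_chain _ _ (fun x => 1 - k / 2 * (1 + sin x ^+ 2)) _ _ _
  (is_derive1_sqrt r0) dr.
move=> /is_derive_eq; apply; rewrite /= -/(amp_speed k x).
by field; rewrite gt_eqF.
Qed.

Lemma continuous_amp_speed_inv k : 0 <= k < 1 ->
  continuous (fun x => (amp_speed k x)^-1).
Proof.
move=> kP x; apply: continuousV; first by rewrite gt_eqF// amp_speed_gt0.
exact: is_derive_continuous (is_derive_amp_speed x kP).
Qed.

Lemma is_derive_amp_time k x : 0 <= k < 1 ->
  is_derive x 1 (amp_time k) (amp_speed k x)^-1.
Proof. by move=> kP; apply: is_derive_primitive; exact: continuous_amp_speed_inv. Qed.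

Lemma pihalf_gt0 : 0 < pi / 2 :> R.
Proof. by rewrite divr_gt0 ?pi_gt0. Qed.

Lemma half_period0 : half_period 0 = pi.
Proof.
have k0 : 0 <= (0 : R) < 1 by rewrite lexx ltr01.
have speed x : (amp_speed 0 x)^-1 = 1.
  by rewrite /amp_speed mul0r mul0r subr0 sqrtr1 invr1.
have d x := is_derive_amp_time x k0.
have le : - (pi / 2) <= pi / 2 :> R by have := pihalf_gt0; lra.
have := is_derive_le_incrementT le d is_derive1_id (fun x _ => _).
have := is_derive_le_incrementT le is_derive1_id d (fun x _ => _).
move=> h1 h2; apply/eqP; rewrite eq_le; apply/andP; split.
  apply: (le_trans (h2 _)) => [x|]; last by lra.
  by rewrite speed.
apply: le_trans (h1 _) => [|x]; first by lra.
by rewrite speed.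
Qed.

Lemma amp_speed_decr k k' x : 0 <= k -> k < k' -> k' < 1 ->
  amp_speed k' x < amp_speed k x.
Proof.
move=> k0 kk k1; have kP : 0 <= k < 1 by rewrite k0 (lt_trans kk).
have := amp_speed_gt0 x kP; rewrite sqrtr_gt0 => r0.
by rewrite /amp_speed ltr_sqrt//; have := sqr_ge0 (sin x); nra.
Qed.

Lemma half_period_incr k k' : 0 <= k -> k < k' -> k' < 1 ->
  half_period k < half_period k'.
Proof.
move=> k0 kk k1; have kP : 0 <= k < 1 by rewrite k0 (lt_trans kk).
have k'P : 0 <= k' < 1 by rewrite k1 (le_trans k0 (ltW kk)).
have le : - (pi / 2) < pi / 2 :> R by have := pihalf_gt0; lra.
apply: (is_derive_lt_increment le) => [x|x|x _]; [exact: is_derive_amp_time..|].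
by rewrite ltf_pV2 ?posrE ?amp_speed_gt0// amp_speed_decr.
Qed.

(** With speeds [q <= p], both at least [e = sqrt (1 - b)], one has
    [1/q - 1/p = (p^2 - q^2) / (p q (p + q))]: the numerator is at most [k' - k], the denominator at
    least [2 e^3], and the phase interval has length [pi]. *)
Lemma half_period_lipschitz k k' b : 0 <= k -> k < k' -> k' <= b -> b < 1 ->
  half_period k' - half_period k <=
  pi / (2 * Num.sqrt (1 - b) ^+ 3) * (k' - k).
Proof.
move=> k0 kk kb b1; have kP : 0 <= k < 1 by rewrite k0 (lt_trans kk (le_lt_trans kb b1)).
have k'P : 0 <= k' < 1 by rewrite (le_lt_trans kb b1) (le_trans k0 (ltW kk)).
have le : - (pi / 2) <= pi / 2 :> R by have := pihalf_gt0; lra.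
set e := Num.sqrt (1 - b).
have e0 : 0 < e by rewrite sqrtr_gt0 subr_gt0.
pose C := (k' - k) / (2 * e ^+ 3).
have dl x : is_derive x 1 (fun y => C * y) C.
  apply: is_derive_eq (is_derive1_mul (is_derive1_const C x) (is_derive1_id x)) _.
  by rewrite mulr1 mulr0 addr0.
have dd x := is_derive1_add (is_derive_amp_time x k'P)
  (is_derive1_opp (is_derive_amp_time x kP)).
have := is_derive_le_incrementT le dd dl.
rewrite (_ : C * _ - _ = pi / (2 * e ^+ 3) * (k' - k)); last first.
  by rewrite /C; field; rewrite gt_eqF.
move=> H; apply: le_trans (H _); first by rewrite /half_period; lra.
move=> x _; set p := amp_speed k x; set q := amp_speed k' x.
have eq_ : e <= q.
  rewrite ler_wsqrtr//; have /andP[+ _] := amp_speed_radicand x (proj1 (andP k'P)).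
  by apply: le_trans; lra.
have qp : q <= p by rewrite ltW// amp_speed_decr//; case/andP: k'P.
have q0 : 0 < q by exact: lt_le_trans eq_.
have p0 : 0 < p by exact: lt_le_trans qp.
have pq : p ^+ 2 - q ^+ 2 <= k' - k.
  by rewrite !sqr_amp_speed//; have := sqr_sin_le1 x; nra.
have -> : q^-1 - p^-1 = (p ^+ 2 - q ^+ 2) / (p * q * (p + q)).
  by field; rewrite !gt_eqF// addr_gt0.
rewrite /C ler_pM//.
- by rewrite subr_ge0 lerXn2r// nnegrE ltW.
- by rewrite invr_ge0 !mulr_ge0 ?addr_ge0 ?ltW.
rewrite lef_pV2 ?posrE ?mulr_gt0 ?exprn_gt0 ?addr_gt0//.
have ep := le_trans eq_ qp.
have e2 : e ^+ 2 <= p * q by rewrite expr2 ler_pM// ltW.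
rewrite (_ : 2 * e ^+ 3 = e ^+ 2 * (2 * e)); last by ring.
by rewrite ler_pM ?sqr_ge0 ?mulr_ge0 ?(ltW e0)//; lra.
Qed.

Lemma half_period_continuous b : 0 <= b < 1 ->
  {within `[0, b], continuous half_period}.
Proof.
move=> /andP[b0 b1]; apply/subspace_continuousP => k /= /[!in_itv]/= /andP[k0 kb].
set C := pi / (2 * Num.sqrt (1 - b) ^+ 3).
have C0 : 0 < C.
  by rewrite divr_gt0 ?pi_gt0// mulr_gt0// exprn_gt0// sqrtr_gt0 subr_gt0.
have lip x y : 0 <= x -> x <= b -> 0 <= y -> y <= b ->
    `|half_period x - half_period y| <= C * `|x - y|.
  wlog xy : x y / x <= y => [H x0 xb y0 yb|x0 xb y0 yb].
    have [/H|/ltW/H] := leP x y; first by apply.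
    by rewrite distrC (distrC x); apply.
  move: xy; rewrite le_eqVlt => /predU1P[->|xy]; first by rewrite !subrr normr0 mulr0.
  rewrite distrC (distrC x) !gtr0_norm ?subr_gt0//.
    exact: half_period_lipschitz.
  by apply: half_period_incr => //; exact: le_lt_trans b1.
apply/cvgrPdist_le => e e0; rewrite near_withinE /=.
near=> y => /[!in_itv]/= /andP[y0 yb].
rewrite (le_trans (lip _ _ _ _ _ _))// -ler_pdivlMl//.
by near: y; apply: cvgr_dist_le; rewrite // mulr_gt0 ?invr_gt0.
Unshelve. all: by end_near. Qed.

(* On [[0, pi / 2]] the speed is at most [e + (pi / 2 - x)] with
   [e = sqrt (1 - k)], so the travel time is at least [- ln e]. *)
Lemma half_period_unbounded (L : R) : exists2 k, 0 <= k < 1 & L <= half_period k.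
Proof.
(* Chosen so that [- ln e = |L| + 1], which exceeds [L]. *)
pose e : R := expR (- (`|L| + 1)).
have e0 : 0 < e by exact: expR_gt0.
have e1 : e < 1 by rewrite expR_lt1 oppr_lt0 ltr_wpDl.
exists (1 - e ^+ 2); first by apply/andP; split; nra.
set k := 1 - _; have kP : 0 <= k < 1 by rewrite /k; apply/andP; split; nra.
have hp := pihalf_gt0.
have left : 0 <= amp_time k 0 - amp_time k (- (pi / 2)).
  have le : - (pi / 2) <= 0 :> R by rewrite oppr_le0 ltW.
  have := is_derive_le_incrementT le (is_derive1_const (0 : R))
    (fun x => is_derive_amp_time x kP).
  rewrite subrr; apply => x _.
  by rewrite (le_trans _ (amp_speed_inv_ge1 x kP)).
pose g x : R := - ln (e + (pi / 2 - x)).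
have dg x : x <= pi / 2 -> is_derive x 1 g (e + (pi / 2 - x))^-1.
  move=> xp; have s0 : 0 < e + (pi / 2 - x) by rewrite ltr_pwDl// subr_ge0.
  have ds := is_derive1_add (is_derive1_const e x) (is_derive1_add
    (is_derive1_const (pi / 2) x) (is_derive1_opp (is_derive1_id x))).
  have dl := @is_derive1_chain _ _ (fun x => e + (pi / 2 - x)) _ _ _
    (is_derive1_ln s0) ds.
  by apply: is_derive_eq (is_derive1_opp dl) _; ring.
have cos_le x : x <= pi / 2 -> cos x <= pi / 2 - x.
  move=> xp; have := is_derive_le_incrementT xp
    (fun x => is_derive1_opp (is_derive_cos x)) is_derive1_id.
  by rewrite cos_pihalf oppr0 sub0r opprK; apply => y _; rewrite opprK sin_le1.
have right : g (pi / 2) - g 0 <= amp_time k (pi / 2) - amp_time k 0.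
  apply: (is_derive_le_increment (ltW hp)).
  - by apply: (is_derive_segment_continuous (df := fun x => (e + (pi / 2 - x))^-1))
      => x /andP[_]; exact: dg.
  - exact: (is_derive_segment_continuous (fun x _ => is_derive_amp_time x kP)).
  - by move=> x /andP[_ /ltW]; exact: dg.
  - by move=> x _; exact: is_derive_amp_time.
  move=> x /andP[x0 xp].
  have s0 : 0 < e + (pi / 2 - x) by rewrite addr_gt0// subr_gt0.
  rewrite lef_pV2 ?posrE ?amp_speed_gt0//.
  rewrite -(@ler_pXn2r _ 2)// ?nnegrE ?ltW ?amp_speed_gt0//.
  (* The squared speed becomes [e^2 + (k / 2) cos^2 x], to be compared with
     [(e + (pi / 2 - x))^2]. *)
  rewrite sqr_amp_speed// sin2cos2 /k.
  have c0 : 0 <= cos x by apply: cos_ge0_pihalf; apply/andP; split; lra.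
  have := cos_le x (ltW xp) => cx; nra.
have : L <= g (pi / 2) - g 0; last by rewrite /half_period; lra.
rewrite /g subrr addr0 subr0 expRK !opprK.
have : 0 <= ln (e + pi / 2).
  by rewrite ln_ge0//; have := pi_ge2 R; lra.
by have := ler_norm L; lra.
Qed.

Lemma ex_half_period (L : R) : pi < L ->
  exists2 k, 0 < k < 1 & half_period k = L.
Proof.
move=> piL; have [b bP Lb] := half_period_unbounded L.
have [|||k] := @IVT R half_period 0 b L.
- by case/andP: bP.
- exact: half_period_continuous.
- rewrite half_period0 ge_min le_max (ltW piL) Lb orbT; exact: isT.
rewrite in_itv/= => /andP[k0 kb] hk; exists k => //.
rewrite (le_lt_trans kb) ?andbT; last by case/andP: bP.
rewrite lt_def k0 andbT; apply/eqP => k0'.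
by move: piL; rewrite -hk k0' half_period0 ltxx.
Qed.

End HalfPeriod.

(** * Construction and classification of the zero-mean solutions *)

Section SymmetricSolutions.
Context {R : realType}.
Set Implicit Arguments.
Unset Strict Implicit.
Implicit Types (f u : R -> R) (c : R * R) (k x y v L : R).

(** Inverting the travel time solves the autonomous equation for the amplitude on the whole line at
    once. *)
Lemma ex_amplitude k : 0 <= k < 1 -> exists ph : R -> R,
  [/\ cancel (amp_time k) ph, cancel ph (amp_time k),
      {mono amp_time k : x y / x < y} &
      forall x, is_derive x 1 ph (amp_speed k (ph x))].
Proof.
move=> kP; have [ph [K1 K2 mono dph]] := ex_inverse_derivative
  (fun x => is_derive_amp_time x kP) (fun x => amp_speed_inv_ge1 x kP).
by exists ph; split => // x; rewrite -[amp_speed _ _]invrK.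
Qed.

(** The speed depends on [sin^2] alone, hence has period [pi]. *)
Lemma amp_time_shift k x : 0 <= k < 1 ->
  amp_time k (x + pi) = amp_time k x + half_period k.
Proof.
move=> kP; pose D y := amp_time k (y + pi) - amp_time k y.
have dD y : is_derive y 1 D 0.
  have ds := is_derive1_add (is_derive1_id y) (is_derive1_const pi y).
  have dc := @is_derive1_chain _ _ (fun y => y + pi) _ _ _
    (is_derive_amp_time (y + pi) kP) ds.
  apply: is_derive_eq (is_derive1_add dc (is_derive1_opp (is_derive_amp_time y kP))) _.
  by rewrite /amp_speed sinDpi sqrrN addr0 mulr1 subrr.
have := is_derive_0_is_cst x (- (pi / 2)) dD.
rewrite /D /half_period (_ : - (pi / 2) + pi = pi / 2); last by field.
by move=> <-; ring.
Qed.

Lemma amp_time_shift2 k x : 0 <= k < 1 ->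
  amp_time k (x + 2 * pi) = amp_time k x + 2 * half_period k.
Proof.
move=> kP; rewrite (_ : x + 2 * pi = x + pi + pi); last by ring.
by rewrite !amp_time_shift//; ring.
Qed.

Lemma half_period_gt0 k : 0 <= k < 1 -> 0 < half_period k.
Proof.
move=> kP; have [ph [_ _ mono _]] := ex_amplitude kP.
by rewrite subr_gt0 mono; have := @pihalf_gt0 R; lra.
Qed.

(* The Jacobi-type functions s = sin phi, c = cos phi, d = phi' satisfy s' = c d,
   c' = - s d and d' = - (k / 2) s c, so the ring they generate is stable under
   differentiation. *)
Inductive generated_by3 (s c d : R -> R) : (R -> R) -> Prop :=
| gen3_1 : generated_by3 s c d s
| gen3_2 : generated_by3 s c d c
| gen3_3 : generated_by3 s c d d
| gen3_const a : generated_by3 s c d (fun=> a)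
| gen3_add f g : generated_by3 s c d f -> generated_by3 s c d g ->
    generated_by3 s c d (fun x => f x + g x)
| gen3_mul f g : generated_by3 s c d f -> generated_by3 s c d g ->
    generated_by3 s c d (fun x => f x * g x).

Lemma generated_by3_smooth (s c d s' c' d' f : R -> R) :
  (forall x, is_derive x 1 s (s' x)) -> (forall x, is_derive x 1 c (c' x)) ->
  (forall x, is_derive x 1 d (d' x)) ->
  generated_by3 s c d s' -> generated_by3 s c d c' -> generated_by3 s c d d' ->
  generated_by3 s c d f -> smooth f.
Proof.
move=> ds dc dd gs gc gd gf.
have step g : generated_by3 s c d g -> exists2 g' : R -> R,
    generated_by3 s c d g' & forall x, is_derive x 1 g (g' x).
  elim=> [|||a|g1 g2 Hg1 [h1 gh1 dh1] Hg2 [h2 gh2 dh2]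
             |g1 g2 Hg1 [h1 gh1 dh1] Hg2 [h2 gh2 dh2]].
  - by exists s'.
  - by exists c'.
  - by exists d'.
  - by exists (fun=> 0); [exact: gen3_const|move=> x; exact: is_derive1_const].
  - exists (fun x => h1 x + h2 x); first exact: gen3_add.
    by move=> x; exact: is_derive1_add.
  - exists (fun x => g1 x * h2 x + g2 x * h1 x).
      by apply: gen3_add; exact: gen3_mul.
    by move=> x; exact: is_derive1_mul.
have gn n : generated_by3 s c d (derive1n n f).
  elim: n => [|n /step[g gg dg]]; first exact: gf.
  rewrite derive1nS (_ : derive1 _ = g)//.
  by apply/funext => x; rewrite derive1E; case: (dg x).
by move=> n x; have [g _ dg] := step _ (gn n); case: (dg x).
Qed.

(* The constants for which the roots of [P c] are [+- sqrt k] and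
   [+- sqrt (2 - k)]. *)
Definition symmetric_const k : R * R := (0, - ((1 - k) ^+ 2 / 4)).

Lemma P_symmetric k v :
  P (symmetric_const k) v = 2^-1 * (k - v ^+ 2) * (2 - k - v ^+ 2).
Proof. by rewrite P_expand /=; field. Qed.

Lemma cos_lt1 x : 0 < x < 2 * pi -> cos x < 1.
Proof.
move=> /andP[x0 x2].
have s0 : 0 < sin (x / 2) by apply: sin_gt0_pi; apply/andP; split; lra.
rewrite (_ : x = (x / 2) *+ 2); last by rewrite mulr2n -splitr.
by rewrite cos_mulr2n cos2sin2; nra.
Qed.

Lemma symmetric_moment k : 0 < k < 1 ->
  moment_integral (symmetric_const k) (- Num.sqrt k) (Num.sqrt k) = 0%E.
Proof.
move=> /andP[k0 k1]; have a0 : 0 < Num.sqrt k by rewrite sqrtr_gt0.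
have a2 : Num.sqrt k ^+ 2 = k by rewrite sqr_sqrtr// ltW.
have lA : Num.sqrt k ^+ 2 < 2 - k by rewrite a2; lra.
have [_] := odd_arcsine_kernel_integral0 0 a0 lA; rewrite sub0r add0r => <-.
by apply: eq_integral => v _; rewrite P_symmetric a2 subr0.
Qed.

(** The substitution [v = sqrt k * sin x] yields the primitive [F], to which the fundamental theorem
    on open intervals applies. *)
Lemma symmetric_time k : 0 < k < 1 ->
  time_integral (symmetric_const k) (- Num.sqrt k) (Num.sqrt k) =
  (half_period k)%:E.
Proof.
move=> /andP[k0 k1]; set a := Num.sqrt k; have a0 : 0 < a by rewrite sqrtr_gt0.
have kP : 0 <= k < 1 by rewrite ltW.
have a2 : a ^+ 2 = k by rewrite sqr_sqrtr// ltW.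
have [ph [K1 K2 mono dph]] := ex_amplitude kP.
have hp := @pihalf_gt0 R.
pose F v := amp_time k (asin (v / a)).
pose U y := a * sin (ph y).
have UA : U (amp_time k (- (pi / 2))) = - a.
  by rewrite /U K1 sinN sin_pihalf mulrN1.
have UB : U (amp_time k (pi / 2)) = a by rewrite /U K1 sin_pihalf mulr1.
(* [asin] is not differentiable at the ends; continuity there comes from [F] being the inverse of
   the continuous map [U]. *)
have cF : {within `[- a, a], continuous F}.
  rewrite -UA -UB; apply: segment_can_le_continuous.
  - by rewrite ltW// mono; lra.
  - apply: continuous_subspaceT => y; have dU := is_derive1_mul
      (is_derive1_const a y) (is_derive1_chain (is_derive_sin (ph y)) (dph y)).
    exact: is_derive_continuous dU.
  - move=> y; rewrite in_itv/= => /andP[y1 y2].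
    rewrite /F /U mulrAC divff ?gt_eqF// mul1r sinK ?K2// in_itv/=.
    by apply/andP; split; rewrite leNgt -mono K2 -leNgt.
have aa : - a < a by lra.
have [cFi Fa Fb] := proj1 (continuous_within_itvP F aa) cF.
have va1 v : - a < v < a -> -1 < v / a < 1.
  by rewrite ltr_pdivlMr// ltr_pdivrMr// mulN1r mul1r.
have Pv0 v : - a < v < a -> 0 < P (symmetric_const k) v.
  move=> /andP[? ?]; have v2 : v ^+ 2 < k by rewrite -a2; nra.
  by rewrite P_symmetric !mulr_gt0//; lra.
have dF v : - a < v < a ->
    is_derive v 1 F (Num.sqrt (P (symmetric_const k) v))^-1.
  move=> vaa; have va := va1 v vaa.
  have v1 : -1 <= v / a <= 1 by move/andP: va => [/ltW -> /ltW ->].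
  have dv := is_derive1_mul (is_derive1_id v) (is_derive1_const a^-1 v).
  have das := @is_derive1_chain _ _ (fun v => v / a) _ _ _ (is_derive1_asin va) dv.
  have dt := @is_derive1_chain _ _ (fun v => asin (v / a)) _ _ _
    (is_derive_amp_time (asin (v / a)) kP) das.
  apply: is_derive_eq dt _; rewrite mulr0 add0r mulr1.
  rewrite -!invfM; congr (_^-1).
  have s0 := amp_speed_gt0 (asin (v / a)) kP.
  rewrite -[LHS]ger0_norm; last by rewrite !mulr_ge0 ?sqrtr_ge0// ltW.
  rewrite -sqrtr_sqr; congr (Num.sqrt _).
  rewrite !exprMn sqr_amp_speed// asinK ?in_itv//= sqr_sqrtr; last first.
    by rewrite subr_ge0; move/andP: v1 => [? ?]; nra.
  by rewrite P_symmetric expr_div_n exprVn a2; field; rewrite gt_eqF.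
rewrite /time_integral (@ge0_continuous_FTC2_oo _ _ F)//.
- rewrite /F mulNr divff ?gt_eqF//; congr _%:E.
  rewrite /half_period; congr (amp_time k _ - amp_time k _).
    by rewrite -[X in asin X]sin_pihalf sinK// in_itv/=; apply/andP; split; lra.
  rewrite -[X in asin (- X)]sin_pihalf -sinN sinK// in_itv/=.
  by apply/andP; split; lra.
- move=> v; rewrite in_itv/= => vaa.
  apply: (@continuousV _ _ (fun v => Num.sqrt (P (symmetric_const k) v))).
    by rewrite gt_eqF// sqrtr_gt0 Pv0.
  by apply: continuous_comp; [exact: continuous_P|exact: sqrt_continuous].
Qed.

Lemma symmetric_solution k : 0 < k < 1 -> exists u,
  [/\ zero_mean_solution (2 * half_period k) (symmetric_const k) u,
      is_min u (- Num.sqrt k) & is_max u (Num.sqrt k)].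
Proof.
move=> /[dup] kk /andP[k0 k1]; set a := Num.sqrt k; have a0 : 0 < a by rewrite sqrtr_gt0.
have kP : 0 <= k < 1 by rewrite ltW.
have a2 : a ^+ 2 = k by rewrite sqr_sqrtr// ltW.
have [ph [K1 K2 mono dph]] := ex_amplitude kP.
have hp := @pihalf_gt0 R; have h0 := half_period_gt0 kP.
pose s x := sin (ph x); pose c x := cos (ph x); pose d x := amp_speed k (ph x).
have ds x : is_derive x 1 s (c x * d x).
  exact: is_derive1_chain (is_derive_sin (ph x)) (dph x).
have dc x : is_derive x 1 c (-1 * (s x * d x)).
  apply: is_derive_eq (is_derive1_chain (is_derive_cos (ph x)) (dph x)) _.
  by rewrite /s /d; ring.
have dd x : is_derive x 1 d (- (k / 2) * (s x * c x)).
  apply: is_derive_eq (is_derive1_chain (is_derive_amp_speed (ph x) kP) (dph x)) _.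
  by rewrite /s /c; field; rewrite gt_eqF// amp_speed_gt0.
pose u x := a * s x.
have du x : is_derive x 1 u (a * (c x * d x)).
  apply: is_derive_eq (is_derive1_mul (is_derive1_const a x) (ds x)) _.
  by rewrite mulr0 addr0.
have su : smooth u.
  apply: (generated_by3_smooth ds dc dd).
  - by apply: gen3_mul; [exact: gen3_2|exact: gen3_3].
  - apply: gen3_mul; first exact: gen3_const.
    by apply: gen3_mul; [exact: gen3_1|exact: gen3_3].
  - apply: gen3_mul; first exact: gen3_const.
    by apply: gen3_mul; [exact: gen3_1|exact: gen3_2].
  - by apply: gen3_mul; [exact: gen3_const|exact: gen3_1].
have umin : is_min u (- a).
  split; first by exists (amp_time k (- (pi / 2))); rewrite // /u /s K1 sinN sin_pihalf mulrN1.
  by move=> _ [x _ <-]; rewrite /u -[leLHS]mulrN1 ler_pM2l// sin_geN1.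
have umax : is_max u a.
  split; first by exists (amp_time k (pi / 2)); rewrite // /u /s K1 sin_pihalf mulr1.
  by move=> _ [x _ <-]; rewrite /u ger_pMr// sin_le1.
exists u; split => //; split.
- split => // x; rewrite derive1E.
  have -> : 'D_1 u x = a * (c x * d x) by case: (du x).
  have := P_symmetric k (u x); rewrite /P => PE_.
  rewrite !exprMn a2 sqr_amp_speed// cos2sin2 -/(s x).
  have -> (p q r : R) : p + q + r = 2^-1 * (2 * (p + q + r)) by field.
  by rewrite PE_ /u exprMn a2; field.
- split; first by rewrite mulr_gt0.
    move=> x; rewrite /u /s; have -> : ph (x + 2 * half_period k) = ph x + 2 * pi.
      by rewrite -[LHS]K1 K2 -[x in LHS]K2 -amp_time_shift2// !K1.
    by rewrite (_ : 2 * pi = pi *+ 2) ?sinD2pi// mulr2n; ring.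
  (* Starting from a maximum, a period [T] leads to another maximum. A shorter [T] would put the
     phase strictly between [pi / 2] and [pi / 2 + 2 * pi], where [sin] is below 1. *)
  move=> T T0 uT; pose y0 := amp_time k (pi / 2).
  have sT : s (y0 + T) = 1.
    have := uT y0; rewrite /u => /mulfI -> //; last by rewrite gt_eqF.
    by rewrite /s /y0 K1 sin_pihalf.
  have phT : pi / 2 < ph (y0 + T) by rewrite -mono K2 ltrDl.
  rewrite leNgt; apply/negP => Tlt.
  have phT2 : ph (y0 + T) < pi / 2 + 2 * pi.
    by rewrite -mono K2 amp_time_shift2// ltrD2l.
  have := @cos_lt1 (ph (y0 + T) - pi / 2).
  rewrite cosBpihalf -/(s (y0 + T)) sT ltxx => H.
  by have : false by apply: H; rewrite subr_gt0 phT ltrBlDl.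
- by exists (- a), a; split => //; exact: symmetric_moment.
Qed.

(** Once the range is centred, [u] is compared with the model having the same constants and the same
    maximum. They are translates, and minimality of both periods gives equality. *)
Lemma zero_mean_solution_symmetric L c u : zero_mean_solution L c u ->
  exists k, [/\ 0 < k < 1, c = symmetric_const k, L = 2 * half_period k,
    is_min u (- Num.sqrt k) & is_max u (Num.sqrt k)].
Proof.
move=> zu; have [su pu [um [uM [umin umax mom]]]] := zu.
have nu := zero_mean_solution_nonconstant zu.
have [] := solution_roots su nu umin umax.
set l := (uM - um) / 2; set m := (um + uM) / 2 => l0 PF B1 B2.
have umE : um = m - l by rewrite /m /l; field.
have uME : uM = m + l by rewrite /m /l; field.
have m0 : m = 0.
  by apply: (moment_integral_eq0_centered l0 PF B1 B2); rewrite -umE -uME.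
have {}umE : um = - l by rewrite umE m0 sub0r.
have {}uME : uM = l by rewrite uME m0 add0r.
pose k := l ^+ 2.
have kl : Num.sqrt k = l by rewrite /k sqrtr_sqr gtr0_norm.
have k0 : 0 < k by rewrite exprn_gt0.
have cE : c = symmetric_const k.
  have := PF 0; have := PF 1; have := PF (-1); rewrite !P_expand m0 -/k /symmetric_const.
  by case: c {su mom PF B1 B2 zu} => c1 c2 /= h1 h2 h3; congr (_, _); lra.
have k_le1 : k <= 1.
  by move: B1; rewrite m0 mulr0 sub0r sqrrN expr0n mulr0 subr0 -/k; lra.
(* For [k = 1] the maximum [l] would be a double root of [P c]: the limiting case of the kinks,
   which are not periodic. *)
have k1 : k < 1.
  rewrite lt_neqAle k_le1 andbT; apply/eqP => kE.
  have := solution_no_double_root su nu umin umax (v := l).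
  rewrite umE uME lexx andbT cE P_symmetric -/k kE.
  have -> : l ^+ 3 - l + (symmetric_const 1).1 = l * (k - 1) by rewrite /k /=; ring.
  rewrite kE subrr !mulr0 mul0r eqxx => H.
  by have : false by apply: H; lra.
have kk : 0 < k < 1 by rewrite k0.
have [U [zU Umin Umax]] := symmetric_solution kk.
rewrite kl in Umin Umax.
have nU := zero_mean_solution_nonconstant zU.
have [sU pU _] := zU; rewrite -cE in sU.
rewrite umE in umin; rewrite uME in umax.
have [[x0 _ ux0] _] := umax; have [[y0 _ Uy0] _] := Umax.
(* The shift that carries a maximum of [u] to a maximum of [U], where both velocities vanish. *)
pose t := y0 - x0.
have ds x : is_derive x 1 (fun x => x + t) 1.
  apply: is_derive_eq (is_derive1_add (is_derive1_id x) (is_derive1_const t x)) _.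
  by rewrite addr0.
have ode (w : R -> R) : solution c w -> (exists x, derive1 w x != 0) ->
    forall x, is_derive x 1 (derive1n 1 w) (w x ^+ 3 - w x + c.1).
  move=> sw nw x; rewrite -(solution_second_order sw nw).
  exact: (smooth_is_derive 1 x sw.1).
have bound (w : R -> R) x : is_min w (- l) -> is_max w l -> `|w x| <= l.
  move=> [_ wm] [_ wM]; rewrite ler_norml.
  by apply/andP; split; [apply: wm|apply: wM]; exists x.
have uE x : u x = U (x + t).
  have dU y : is_derive y 1 (fun x => U (x + t)) (derive1n 1 U (y + t)).
    apply: is_derive_eq (@is_derive1_chain _ U (fun x => x + t) _ _ _
      (smooth_is_derive 0 (y + t) sU.1) (ds y)) _.
    by rewrite mulr1.
  have dU' y : is_derive y 1 (fun x => derive1n 1 U (x + t))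
      (U (y + t) ^+ 3 - U (y + t) + c.1).
    apply: is_derive_eq (@is_derive1_chain _ (derive1n 1 U) (fun x => x + t) _ _ _
      (ode U sU nU (y + t)) (ds y)) _.
    by rewrite mulr1.
  have e0 : u x0 = U (x0 + t) by rewrite /t addrC subrK ux0 Uy0.
  have e1 : derive1n 1 u x0 = derive1n 1 U (x0 + t).
    rewrite /t addrC subrK !derive1n1.
    rewrite (derive1_global_max su.1 ux0 umax.2).
    by rewrite (derive1_global_max sU.1 Uy0 Umax.2).
  exact: (second_order_unique (fun y => smooth_is_derive 0 y su.1) (ode u su nu)
    dU dU' (fun y => bound u y umin umax) (fun y => bound U _ Umin Umax) e0 e1).
exists k; rewrite kl; split => //.
case: pu => L0 perL minL; case: pU => h0 perU minU.
apply/eqP; rewrite eq_le; apply/andP; split.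
  apply: minL; first exact: h0.
  move=> x; rewrite !uE -(perU (x + t)); congr (U _); ring.
apply: minU => // x; have := perL (x - t); rewrite !uE subrK => <-.
by congr (U _); ring.
Qed.

End SymmetricSolutions.

(** * Membership in [calC]: [r] is a genuine, positive supremum *)

Section FourRoots.
Context {R : realType}.
Set Implicit Arguments.
Unset Strict Implicit.

(** The signs of [P] at [-3, -1, 0, 1, 3] alternate; [c1 < - c2] keeps the value at 1 negative. *)
Lemma four_roots_perturbed (c1 c2 : R) : - 4^-1 < c2 -> 0 < c1 -> c1 < - c2 ->
  four_roots (c1, c2).
Proof.
move=> c2N c10 c12.
have root (a b : R) : a < b -> P (c1, c2) a * P (c1, c2) b < 0 ->
    exists2 v, a < v < b & P (c1, c2) v = 0.
  move=> ab Pab; have [|||v] := @IVT R (P (c1, c2)) a b 0.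
  - exact: ltW.
  - by apply: continuous_subspaceT; exact: continuous_P.
  - rewrite ge_min le_max; apply/andP; split; apply/orP.
      have [Pa|Pa] := leP (P (c1, c2) a) 0; [by left|right].
      by rewrite ltW// -(pmulr_rlt0 _ Pa).
    have [Pa|Pa] := leP 0 (P (c1, c2) a); [by left|right].
    by rewrite ltW// -(nmulr_rlt0 _ Pa).
  rewrite in_itv/= => /andP[av vb] Pv; exists v => //.
  rewrite !lt_neqAle av vb !andbT; apply/andP; split; apply/eqP => E.
    by move: Pab; rewrite E Pv mul0r ltxx.
  by move: Pab; rewrite -E Pv mulr0 ltxx.
have PN3 : 0 < P (c1, c2) (-3) by rewrite P_expand /=; lra.
have PN1 : P (c1, c2) (-1) < 0 by rewrite P_expand /=; lra.
have P0 : 0 < P (c1, c2) 0 by rewrite P_expand /=; lra.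
have P1 : P (c1, c2) 1 < 0 by rewrite P_expand /=; lra.
have P3 : 0 < P (c1, c2) 3 by rewrite P_expand /=; lra.
have [||u1 /andP[_ u1N] E1] := root (-3) (-1); [lra|by rewrite pmulr_rlt0|].
have [||um /andP[umN um0] Em] := root (-1) 0; [lra|by rewrite nmulr_rlt0|].
have [||uM /andP[uM0 uM1] EM] := root 0 1; [lra|by rewrite pmulr_rlt0|].
have [||u2 /andP[u21 _] E2] := root 1 3; [lra|by rewrite nmulr_rlt0|].
by exists u1, um, uM, u2; split; split => //; lra.
Qed.

(** Without an upper bound [sup] would take its default value. The root [uM > 0] satisfies
    [4 c1 uM < 1] and [2 c1 < uM], which is impossible for [c1 > 1]. *)
Lemma four_roots_le1 (c1 c2 : R) : - 4^-1 < c2 < 0 -> 0 < c1 ->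
  four_roots (c1, c2) -> c1 <= 1.
Proof.
move=> /andP[c2N c20] c10 [u1 [um [uM [u2 [[_ _ uM0 _] [_ _ + _]]]]]].
rewrite P_expand /= => E; have := sqr_ge0 (uM ^+ 2) => u4.
have c1u : 4 * c1 * uM < 1 by have := sqr_ge0 (uM ^+ 2 - 1); nra.
have c1lt : 2 * c1 < uM.
  rewrite -(ltr_pM2r uM0).
  by have -> : 2 * c1 * uM = 2^-1 * (4 * c1 * uM); [field|nra].
by rewrite leNgt; apply/negP => c11; nra.
Qed.

Lemma calC_symmetric (k : R) : 0 < k < 1 -> calC R (symmetric_const k).
Proof.
move=> /andP[k0 k1]; have c2 : - 4^-1 < (symmetric_const k).2 < 0.
  by rewrite /=; apply/andP; split; nra.
split => //; rewrite normr0.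
move: c2; set c2 := (symmetric_const k).2 => /andP[c2N c20].
(* As [c1 = 0], only [0 < r c2] is at stake, and [- c2 / 2] belongs to the set defining [r c2]. *)
apply: (@lt_le_trans _ _ (- c2 / 2)); first by rewrite divr_gt0// oppr_gt0.
apply: ub_le_sup.
  by exists 1 => c1 [c10]; apply: four_roots_le1; rewrite ?c2N.
by split; [lra|apply: four_roots_perturbed => //; lra].
Qed.

End FourRoots.

Theorem theorem2p8 (R : realType) :
  exists (L0 : R) (E : set R),
    [/\ 0 < L0,
        E `<=` `[L0, +oo[,
        (@lebesgue_measure R).-negligible E,
        (forall L : R, 0 < L -> L < L0 ->
          ~ exists (c : R * R) (u : R -> R), zero_mean_solution L c u)
      & (forall L : R, (`[L0, +oo[ `\` E) L ->
          [/\ calP L !=set0,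
              finite_set (calP L)
            & forall c : R * R, calP L c ->
              forall (u : R -> R) (um uM : R),
                zero_mean_solution L c u -> is_min u um -> is_max u uM ->
                time_integral c um uM = (L / 2)%:E])].
Proof.
have pi0 := @pi_gt0 R.
have half_gt (k : R) : 0 < k < 1 -> pi < half_period k.
  by move=> /andP[k0 k1]; rewrite -[ltLHS]half_period0 half_period_incr.
(* The value [2 * pi] is only the limit of the periods as [k] tends to 0: no solution attains it, so
   non-emptiness fails there and it goes into [E]. *)
exists (2 * pi), [set 2 * pi]; split.
- by rewrite mulr_gt0.
- by move=> _ ->; rewrite /= in_itv/= lexx.
- by exists [set 2 * pi]; split => //; exact: lebesgue_measure_set1.
- move=> L _ L2 [c [u /zero_mean_solution_symmetric[k [kk _ LE _ _]]]].
  by have := half_gt k kk; move: L2; rewrite LE; lra.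
move=> L [/=]; rewrite in_itv/= andbT => L2 /eqP LE.
have piL : pi < L / 2.
  by rewrite ltr_pdivlMr// mulrC lt_neqAle eq_sym LE.
have [k kk hk] := ex_half_period piL.
have calPE c : calP L c -> c = symmetric_const k.
  move=> [_ [u /zero_mean_solution_symmetric[k' [kk' -> L'E _ _]]]].
  congr symmetric_const; move: kk kk' => /andP[k0 k1] /andP[k'0 k'1].
  have hkk : half_period k' = half_period k by rewrite hk L'E; field.
  case: (ltgtP k' k) => // lt_kk.
    by have := half_period_incr (ltW k'0) lt_kk k1; rewrite hkk ltxx.
  by have := half_period_incr (ltW k0) lt_kk k'1; rewrite hkk ltxx.
split.
- exists (symmetric_const k); split; first exact: calC_symmetric.
  have [u [zu _ _]] := symmetric_solution kk.
  by exists u; move: zu; rewrite hk (_ : 2 * (L / 2) = L)//; field.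
- by apply: (@sub_finite_set _ _ [set symmetric_const k]); [move=> c /calPE|].
move=> c _ u um uM /zero_mean_solution_symmetric[k' [kk' -> -> kmin kmax]] umin umax.
have -> : um = - Num.sqrt k'.
  by apply/eqP; rewrite eq_le (umin.2 _ kmin.1) (kmin.2 _ umin.1).
have -> : uM = Num.sqrt k'.
  by apply/eqP; rewrite eq_le (umax.2 _ kmax.1) (kmax.2 _ umax.1).
by rewrite symmetric_time//; congr _%:E; field.
Qed.
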